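(* Let $q$ be a power of an odd prime with $q\equiv 3 \pmod 4$, let $d=4k+3$ with $k$ a positive integer, and let $P=\{(x_1,\dots,x_{d-1},x_d)\in\mathbb F_q^d: x_d=x_1^2+\cdots+x_{d-1}^2\}$ be the paraboloid. Then \[R_P^*\left(2\to \frac{2d+4}{d}\right)\ll 1,\] with implicit constant independent of $q$.
   Context: $\mathbb F_q$ is the finite field with $q$ elements ($q$ odd), $\chi$ a fixed nontrivial additive character of $\mathbb F_q$. For a set $V\subset\mathbb F_q^d$ and $f:V\to\mathbb C$, put $(fd\sigma)^\vee(m)=\frac{1}{|V|}\sum_{x\in V}\chi(m\cdot x)f(x)$ for $m\in\mathbb F_q^d$, $\|F\|_{L^r(\mathbb F_q^d,dc)}=(\sum_{m\in\mathbb F_q^d}|F(m)|^r)^{1/r}$ and $\|f\|_{L^p(V,d\sigma)}=(\frac1{|V|}\sum_{x\in V}|f(x)|^p)^{1/p}$. $R_V^*(p\to r)$ denotes the smallest constant such that $\|(fd\sigma)^\vee\|_{L^r(\mathbb F_q^d,dc)}\le R_V^*(p\to r)\|f\|_{L^p(V,d\sigma)}$ for all $f:V\to\mathbb C$. $X\ll Y$ means $X\le CY$ for an absolute constant $C$ (independent of $q$). *)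

(* Defs.v *)
From HB Require Import structures.
From mathcomp Require Import all_boot all_order all_algebra all_field.
From mathcomp Require Import complex.
From mathcomp Require Import reals exp.
Set Implicit Arguments. Unset Strict Implicit. Unset Printing Implicit Defensive.
Import Order.TTheory GRing.Theory Num.Theory.
Local Open Scope ring_scope.

Section Extension.
Variables (R : realType) (F : finFieldType).

Definition additive_character (chi : F -> complex R) : Prop :=
  chi 0 = 1 /\ forall a b, chi (a + b) = chi a * chi b.

Definition nontrivial_additive_character (chi : F -> complex R) : Prop :=
  additive_character chi /\ exists a, chi a != 1.

Definition cabs (z : complex R) : R := Normc.normc z.

Definition dotv n (m x : 'rV[F]_n) : F := \sum_(i < n) m 0 i * x 0 i.

Definition ext_op n (V : {set 'rV[F]_n}) (chi : F -> complex R)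
    (f : 'rV[F]_n -> complex R) (m : 'rV[F]_n) : complex R :=
  (#|V|%:R)^-1 * \sum_(x in V) chi (dotv m x) * f x.

Definition norm_count n (r : R) (G : 'rV[F]_n -> complex R) : R :=
  powR (\sum_(m : 'rV[F]_n) powR (cabs (G m)) r) r^-1.

Definition norm_sigma n (V : {set 'rV[F]_n}) (p : R) (f : 'rV[F]_n -> complex R) : R :=
  powR ((#|V|%:R)^-1 * \sum_(x in V) powR (cabs (f x)) p) p^-1.

(* A is an admissible constant for R_V^*(p -> r) w.r.t. chi, i.e.
   R_V^*(p -> r) <= A *)
Definition extension_bound n (V : {set 'rV[F]_n}) (chi : F -> complex R) (p r A : R) : Prop :=
  forall f : 'rV[F]_n -> complex R,
    norm_count r (ext_op V chi f) <= A * norm_sigma V p f.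

Definition paraboloid n : {set 'rV[F]_n.+1} :=
  [set x : 'rV[F]_n.+1 | x 0 ord_max == \sum_(i < n) x 0 (widen_ord (leqnSn n) i) ^+ 2].

End Extension.

(* Main.v *)
(* By duality it suffices to bound the restriction to [P] of the Fourier transform of a
   unimodular function supported on the level sets of an extension; all level sets are
   summed at the end, which gives the strong-type endpoint because the two estimates below
   balance only at the critical level [q^(-d/4)] and gain geometrically away from it.
   Below that level Plancherel is enough. Above it, follow Mockenhaupt and Tao: cut the
   level set into horizontal slices; the Fourier transform of the surface measure turns
   each slice, read as a subset [A] of [F^(d-1)] lifted to [P], into an extension whose
   fourth power is counted by the additive energy of the lifted set.
   This energy counts rectangles in [A] and is [O(|A|^3/q + q^((d-2)/2) |A|^2)].
   Rectangles with an isotropic side are few because, for [q = 3 mod 4] and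
   [d - 1 = 2 mod 4], the quadratic Gauss sum in dimension [d - 1] is negative, so that the
   large Fourier coefficients of the zero sphere have a favourable sign. For the others,
   a right angle at [c] with leg [a - c] is an incidence of [b] with the hyperplane through
   [c] normal to [a - c]; a second moment bound applies, since [a] and the hyperplane
   determine [c] as the foot of a perpendicular. *)
Require Import Defs.
From HB Require Import structures.
From mathcomp Require Import all_boot all_order all_algebra all_field.
From mathcomp Require Import complex.
From mathcomp Require Import reals exp.
From mathcomp Require Import fingroup cyclic.
From mathcomp Require Import ring lra zify.
Import Order.TTheory GRing.Theory Num.Theory.
Local Open Scope ring_scope.
Set Implicit Arguments. Unset Strict Implicit. Unset Printing Implicit Defensive.

(** * Characters *)

Section ComplexModulus.
Variable R : realType.
Implicit Types z : complex R.

Lemma cabsE z : (cabs z)%:C%C = `|z|.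
Proof. by []. Qed.

Lemma cabs_ge0 z : 0 <= cabs z.
Proof. by rewrite -ler0c cabsE. Qed.

Lemma cabsM z1 z2 : cabs (z1 * z2) = cabs z1 * cabs z2.
Proof. exact: Normc.normcM. Qed.

Lemma cabs1 : cabs (1 : complex R) = 1.
Proof. exact: Normc.normc1. Qed.

Lemma cabs0 : cabs (0 : complex R) = 0.
Proof. exact: Normc.normc0. Qed.

Lemma cabsX z n : cabs (z ^+ n) = cabs z ^+ n.
Proof. by elim: n => [|n IH]; rewrite ?expr0 ?cabs1 // !exprS cabsM IH. Qed.

Lemma cabsJ z : cabs z^*%C = cabs z.
Proof. by apply: complexI; rewrite !cabsE normcJ. Qed.

Lemma cabs_sqr z : (cabs z ^+ 2)%:C%C = z * z^*%C.
Proof. by rewrite rmorphXn /= -sqr_normc. Qed.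

Lemma cabs_nat n : cabs (n%:R : complex R) = n%:R.
Proof. by apply: complexI; rewrite cabsE rmorph_nat normr_nat. Qed.

Lemma cabs_real (x : R) : 0 <= x -> cabs x%:C%C = x.
Proof. by move=> x0; apply: complexI; rewrite cabsE ger0_norm // ler0c. Qed.

Lemma cabs_sum (I : Type) (r : seq I) (P : pred I) (f : I -> complex R) :
  cabs (\sum_(i <- r | P i) f i) <= \sum_(i <- r | P i) cabs (f i).
Proof.
by rewrite -lecR cabsE rmorph_sum /=; apply: ler_norm_sum.
Qed.

End ComplexModulus.

Section Dot.
Variables (F : finFieldType) (n : nat).
Implicit Types x y z : 'rV[F]_n.

Lemma dotvC x y : dotv x y = dotv y x.
Proof. by apply: eq_bigr => i _; rewrite mulrC. Qed.

Lemma dotvDr x y z : dotv x (y + z) = dotv x y + dotv x z.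
Proof. by rewrite -big_split; apply: eq_bigr => i _; rewrite mxE mulrDr. Qed.

Lemma dotvZr a x y : dotv x (a *: y) = a * dotv x y.
Proof. by rewrite mulr_sumr; apply: eq_bigr => i _; rewrite mxE mulrCA. Qed.

Lemma dotvDl x y z : dotv (y + z) x = dotv y x + dotv z x.
Proof. by rewrite !(dotvC _ x) dotvDr. Qed.

Lemma dotvZl a x y : dotv (a *: y) x = a * dotv y x.
Proof. by rewrite !(dotvC _ x) dotvZr. Qed.

Lemma dotvNr x y : dotv x (- y) = - dotv x y.
Proof. by rewrite -scaleN1r dotvZr mulN1r. Qed.

Lemma dotvNl x y : dotv (- y) x = - dotv y x.
Proof. by rewrite !(dotvC _ x) dotvNr. Qed.

Lemma dotv0r x : dotv x 0 = 0.
Proof. by rewrite -(scale0r x) dotvZr mul0r. Qed.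

Lemma dotv0l x : dotv 0 x = 0.
Proof. by rewrite dotvC dotv0r. Qed.

Definition dotvE := (dotvDl, dotvDr, dotvNl, dotvNr, dotvZl, dotvZr).

(** Supplies the frequencies at which a nontrivial character detects x, so that sums over all m
    cancel. *)
Lemma dotv_neq0 x : x != 0 -> exists m, forall a, dotv (a *: m) x = a.
Proof.
move=> x0; have [i xi] : exists i, x 0 i != 0.
  apply/existsP; apply: contraR x0 => /existsPn H.
  by apply/eqP/rowP => i; rewrite mxE; apply/eqP; rewrite -[_ == _]negbK H.
exists ((x 0 i)^-1 *: delta_mx 0 i) => a; rewrite !dotvZl.
rewrite /dotv (bigD1 i) //= big1 ?addr0 => [|j ji]; last first.
  by rewrite mxE (negbTE ji) mul0r.
by rewrite mxE !eqxx mul1r mulVf // mulr1.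
Qed.

End Dot.

Section Characters.
Variables (R : realType) (F : finFieldType) (chi : F -> complex R).
Hypothesis chiP : nontrivial_additive_character chi.

Lemma chi0 : chi 0 = 1.
Proof. by case: chiP => -[]. Qed.

Lemma chiD a b : chi (a + b) = chi a * chi b.
Proof. by case: chiP => -[_ ->]. Qed.

(** The characteristic p annihilates a, so [chi a] is a p-th root of unity. *)
Lemma cabs_chi a : cabs (chi a) = 1.
Proof.
have [p p_pr pF] := finPcharP F.
have chiMn m : chi (a *+ m) = chi a ^+ m.
  by elim: m => [|m IH]; rewrite ?mulr0n ?chi0 // mulrS chiD IH exprS.
have /eqP : cabs (chi a) ^+ p = 1 by rewrite -cabsX -chiMn mulrn_pchar // chi0 cabs1.
by rewrite -(prednK (prime_gt0 p_pr)) pexpr_eq1 ?cabs_ge0 // => /eqP.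
Qed.

Lemma chiN a : chi (- a) = (chi a)^*%C.
Proof.
have h : chi a * (chi a)^*%C = 1 by rewrite -cabs_sqr cabs_chi expr1n.
have h' : chi a * chi (- a) = 1 by rewrite -chiD subrr chi0.
have /mulfI : chi a != 0 by apply: contra_eq_neq h => ->; rewrite mul0r eq_sym oner_eq0.
by apply; rewrite h'.
Qed.

(** Translation by [x0] permutes the group and multiplies the sum by [psi x0], which is not 1. *)
Lemma sum_character0 (V : finZmodType) (psi : V -> complex R) x0 :
  (forall x y, psi (x + y) = psi x * psi y) -> psi x0 != 1 -> \sum_x psi x = 0.
Proof.
move=> psiD psi1; have : \sum_x psi x = psi x0 * \sum_x psi x.
  rewrite {1}(reindex_inj (addrI x0)) mulr_sumr.
  by apply: eq_bigr => x _; rewrite psiD.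
move/eqP; rewrite -subr_eq0 -{1}(mul1r (\sum_x _)) -mulrBl mulf_eq0 subr_eq0.
by rewrite eq_sym (negbTE psi1) => /eqP.
Qed.

Lemma sum_chi_dotv n (x : 'rV[F]_n) :
  \sum_m chi (dotv m x) = (x == 0)%:R * (#|F| ^ n)%:R.
Proof.
have [->|x0] := eqVneq x 0.
  under eq_bigr do rewrite dotv0r chi0.
  by rewrite sumr_const card_mx mul1n mul1r.
have [m mP] := dotv_neq0 x0; have [_ [a ha]] := chiP.
rewrite mul0r; apply: (@sum_character0 _ (fun m => chi (dotv m x)) (a *: m)).
  by move=> m1 m2; rewrite dotvDl chiD.
by rewrite mP.
Qed.

Lemma sum_chi t : \sum_a chi (a * t) = (t == 0)%:R * #|F|%:R.
Proof.
have [->|t0] := eqVneq t 0.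
  under eq_bigr do rewrite mulr0 chi0.
  by rewrite sumr_const mul1r.
have [_ [a ha]] := chiP.
rewrite mul0r; apply: (@sum_character0 _ (fun a => chi (a * t)) (a / t)).
  by move=> b c; rewrite mulrDl chiD.
by rewrite divfK.
Qed.

(** Collisions of [phi] are kept: with sums of two points as frequencies this gives fourth
    moments. *)
Lemma plancherel n (I : finType) (phi : I -> 'rV[F]_n) (c : I -> complex R) :
  (\sum_m cabs (\sum_i c i * chi (dotv m (phi i))) ^+ 2)%:C%C =
  (#|F| ^ n)%:R * \sum_i \sum_j (phi i == phi j)%:R * (c i * (c j)^*%C).
Proof.
rewrite rmorph_sum /=.
under eq_bigr => m _ do rewrite cabs_sqr rmorph_sum mulr_suml.
rewrite exchange_big mulr_sumr; apply: eq_bigr => i _.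
under eq_bigr => m _ do rewrite mulr_sumr.
rewrite exchange_big mulr_sumr; apply: eq_bigr => j _ /=.
rewrite -subr_eq0 mulrA (mulrC (#|F| ^ n)%:R) -sum_chi_dotv mulr_suml.
by apply: eq_bigr => m _; rewrite rmorphM /= -chiN dotvDr dotvNr chiD mulrACA mulrC.
Qed.

Lemma plancherel_le n (I : finType) (P : pred I) (phi : I -> 'rV[F]_n)
    (c : I -> complex R) :
  (forall i, cabs (c i) <= (P i)%:R) ->
  \sum_m cabs (\sum_i c i * chi (dotv m (phi i))) ^+ 2 <=
  (#|F| ^ n)%:R * \sum_(i | P i) \sum_(j | P j) (phi i == phi j)%:R.
Proof.
move=> c1; rewrite -[leLHS]cabs_real; last first.
  by apply: sumr_ge0 => m _; rewrite exprn_ge0 ?cabs_ge0.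
rewrite plancherel cabsM cabs_nat ler_wpM2l // [leRHS]big_mkcond.
apply: (le_trans (cabs_sum _ _ _)); apply: ler_sum => i _.
apply: (le_trans (cabs_sum _ _ _)).
apply: (@le_trans _ _ (\sum_j (phi i == phi j)%:R * ((P i)%:R * (P j)%:R))).
  by apply: ler_sum => j _; rewrite !cabsM cabsJ cabs_nat ler_wpM2l // ler_pM ?cabs_ge0.
case: (P i); last by rewrite big1 // => j _; rewrite mul0r mulr0.
rewrite [leRHS]big_mkcond /=; apply: ler_sum => j _.
by rewrite mul1r; case: (P j); rewrite ?mulr1 ?mulr0.
Qed.

Lemma plancherel_inj n (I : finType) (phi : I -> 'rV[F]_n) (c : I -> complex R) :
  injective phi ->
  \sum_m cabs (\sum_i c i * chi (dotv m (phi i))) ^+ 2 =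
  (#|F| ^ n)%:R * \sum_i cabs (c i) ^+ 2.
Proof.
move=> phi_inj; apply: complexI; rewrite plancherel rmorphM rmorph_nat rmorph_sum /=.
congr (_ * _); apply: eq_bigr => i _.
rewrite (bigD1 i) //= eqxx mul1r -cabs_sqr big1 ?addr0 // => j ji.
by rewrite (inj_eq phi_inj) eq_sym (negbTE ji) mul0r.
Qed.

End Characters.

(** * Gauss sums *)

Section ThreeModFour.
Variable F : finFieldType.
Hypothesis qF : (#|F| %% 4 = 3)%N.

(** If 2 were 0, then 1 would have additive order 2, which would divide the odd number [#|F|]. *)
Lemma two_neq0 : (2 : F) != 0.
Proof.
have : odd #|F| by rewrite (divn_eq #|F| 4) qF oddD oddM andbF.
apply: contraL => /eqP h2.
have o2 : (#[1%R : F]%g %| 2)%N by rewrite order_dvdn FinRing.zmodXgE h2.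
have o1 : #[1%R : F]%g != 1%N by rewrite order_eq1 FinRing.zmod1gE oner_eq0.
rewrite -cardsT -dvdn2.
suff <- : #[1%R : F]%g = 2%N by apply/order_dvdG/in_setT.
by move: o2; rewrite dvdn_divisors // !inE (negPf o1) => /eqP.
Qed.

Lemma four_neq0 : (4 : F) != 0.
Proof. by have := mulf_neq0 two_neq0 two_neq0; rewrite -natrM. Qed.

Lemma eqN1_1 : (-1 == 1 :> F) = false.
Proof. by rewrite -subr_eq0 -opprD oppr_eq0 (negPf two_neq0). Qed.

(* The nonzero squares form a subgroup of odd order [#|F|./2], so that it does
   not contain [-1]; this is what makes the next function bijective. *)
Definition twisted_square (x : F) : F :=
  if x ^+ (#|F|./2) == 1 then x ^+ 2 else - x ^+ 2.

Lemma odd_half_card : odd (#|F|./2).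
Proof. by move: qF; lia. Qed.

Lemma sqr_half_card (x : F) : x != 0 -> (x ^+ 2) ^+ (#|F|./2) = 1.
Proof.
move=> x0; apply: (mulfI x0); rewrite -exprM -exprS mulr1 -[RHS]expf_card.
by congr (_ ^+ _); move: qF; lia.
Qed.

Lemma twisted_square_bij : bijective twisted_square.
Proof.
apply: injF_bij => x y.
have sq0 (z : F) : (twisted_square z == 0) = (z == 0).
  by rewrite /twisted_square; case: ifP; rewrite ?oppr_eq0 expf_eq0.
have [->|x0] := eqVneq x 0.
  by move/eqP; rewrite eq_sym (eqP (_ : twisted_square 0 == 0)) sq0 // => /eqP.
have [->|y0] := eqVneq y 0.
  by move/eqP; rewrite (eqP (_ : twisted_square 0 == 0)) sq0 // => /eqP.
(* A twisted square has the same quadratic character as its argument. *)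
have half (z : F) : z != 0 -> (z ^+ (#|F|./2) == 1) = ((twisted_square z) ^+ (#|F|./2) == 1).
  move=> z0; rewrite /twisted_square; case: ifP; first by rewrite sqr_half_card ?eqxx.
  by rewrite exprNn sqr_half_card // -signr_odd odd_half_card mulr1 eqN1_1.
have sgn (z : F) : z != 0 -> (z ^+ (#|F|./2) == 1) || (z ^+ (#|F|./2) == -1).
  move=> z0; have := sqrf_eq1 (z ^+ (#|F|./2)).
  by rewrite exprAC sqr_half_card // eqxx => <-.
move=> e; have := half _ x0; rewrite e -half // => exy.
have /eqP : x ^+ 2 = y ^+ 2.
  by move: e; rewrite /twisted_square exy; case: ifP => // _ /oppr_inj.
(* Equal squares leave the alternative x = -y, but [#|F|./2] is odd, so this change of sign would
   change the quadratic character. *)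
rewrite eqf_sqr => /orP[/eqP //|/eqP exyN]; exfalso; move: exy.
rewrite {1}exyN exprNn -signr_odd odd_half_card expr1 mulN1r.
by case/orP: (sgn _ y0) => /eqP->; rewrite ?opprK eqxx eqN1_1.
Qed.

Variables (R : realType) (chi : F -> complex R).
Hypothesis chiP : nontrivial_additive_character chi.

Definition gauss n (s : F) : complex R := \sum_(x : 'rV[F]_n) chi (s * dotv x x).

Lemma gaussX n s : gauss n s = (\sum_x chi (s * x ^+ 2)) ^+ n.
Proof.
rewrite -[n in RHS]card_ord -prodr_const bigA_distr_bigA /=.
rewrite (reindex (fun x : 'rV[F]_n => [ffun i => x 0 i])) /=; last first.
  exists (fun f : {ffun 'I_n -> F} => \row_i f i) => f _.
    by apply/rowP => i; rewrite mxE ffunE.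
  by apply/ffunP => i; rewrite ffunE mxE.
apply: eq_bigr => x _; rewrite /dotv mulr_sumr.
rewrite (big_morph chi (chiD chiP) (chi0 chiP)).
by apply: eq_bigr => i _; rewrite ffunE expr2.
Qed.

Lemma gauss1_norm s : s != 0 ->
  (\sum_x chi (s * x ^+ 2)) * (\sum_x chi (s * x ^+ 2))^*%C = #|F|%:R.
Proof.
move=> s0; rewrite rmorph_sum mulrC mulr_suml /=.
(* Substituting y + z for the other variable makes the phase linear in y; summing over y leaves only
   z = 0. *)
transitivity (\sum_y \sum_z chi (s * z ^+ 2) * chi (y * (2 * s * z))).
  apply: eq_bigr => y _; rewrite mulr_sumr (reindex_inj (addrI y)).
  apply: eq_bigr => z _; rewrite -(chiN chiP) -!(chiD chiP); congr chi; ring.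
rewrite exchange_big /=; under eq_bigr => z _ do rewrite -mulr_sumr sum_chi //.
rewrite (bigD1 0) //= big1 => [|z z0]; last first.
  by rewrite !mulf_eq0 (negPf two_neq0) (negPf s0) (negPf z0) mul0r mulr0.
by rewrite expr0n !mulr0 eqxx (chi0 chiP) !mul1r addr0.
Qed.

(** The sum and its conjugate run over x^2 and -x^2. Exchanging the two where needed turns them into
    two complete character sums, which vanish; so the Gauss sum is purely imaginary. *)
Lemma gauss1_conj s : s != 0 ->
  (\sum_x chi (s * x ^+ 2))^*%C = - \sum_x chi (s * x ^+ 2).
Proof.
move=> s0; apply/eqP; rewrite -addr_eq0 rmorph_sum -big_split /=; apply/eqP.
transitivity (\sum_x (chi (twisted_square x * s) + chi (twisted_square x * (- s)))).
  apply: eq_bigr => x _; rewrite -(chiN chiP) /twisted_square.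
  by case: ifP; rewrite ?mulrN ?mulNr ?opprK (mulrC s) // addrC.
have S t : \sum_x chi (twisted_square x * t) = \sum_y chi (y * t).
  by rewrite [RHS](reindex twisted_square) //; apply: onW_bij; apply: twisted_square_bij.
rewrite big_split /= !S.
by rewrite !sum_chi // oppr_eq0 (negPf s0) !mul0r addr0.
Qed.

(** A purely imaginary number of squared modulus q has square -q, and the odd exponent 2k + 1 keeps
    the sign, for all nonzero s alike. *)
Lemma gauss_3mod4 k s : s != 0 -> gauss (4 * k + 2) s = - (#|F| ^ (2 * k + 1))%:R.
Proof.
move=> s0; rewrite gaussX (_ : 4 * k + 2 = 2 * (2 * k + 1))%N; last by lia.
rewrite exprM expr2 -[X in X * _]opprK -gauss1_conj // mulNr mulrC gauss1_norm //.
by rewrite exprNn -signr_odd oddD oddM /= expr1 mulN1r natrX.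
Qed.

(** Completion of the square. *)
Lemma gauss_shift n s (x : 'rV[F]_n) : s != 0 ->
  \sum_y chi (s * dotv y y + dotv y x) =
  chi (- (4 * s)^-1 * dotv x x) * gauss n s.
Proof.
move=> s0; rewrite (reindex_inj (addIr (- (2 * s)^-1 *: x))) mulr_sumr /=.
apply: eq_bigr => y _; rewrite -(chiD chiP); congr chi.
rewrite !dotvE (dotvC x y); field.
by rewrite two_neq0 four_neq0 s0.
Qed.

End ThreeModFour.

(** * Isotropic pairs *)

Section CauchySchwarz.
Variables (R : realType) (I : finType) (P : pred I).

(** By Lagrange's identity, twice the defect is a double sum of squares. *)
Lemma cauchy_schwarz (x y : I -> R) :
  (\sum_(i | P i) x i * y i) ^+ 2 <=
  (\sum_(i | P i) x i ^+ 2) * (\sum_(i | P i) y i ^+ 2).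
Proof.
have : 0 <= \sum_(i | P i) \sum_(j | P j) (x i * y j - x j * y i) ^+ 2.
  by apply: sumr_ge0 => i _; apply: sumr_ge0 => j _; rewrite sqr_ge0.
have -> : \sum_(i | P i) \sum_(j | P j) (x i * y j - x j * y i) ^+ 2 =
    (\sum_(i | P i) x i ^+ 2) * (\sum_(j | P j) y j ^+ 2) +
    (\sum_(i | P i) y i ^+ 2) * (\sum_(j | P j) x j ^+ 2) -
    2 * ((\sum_(i | P i) x i * y i) * (\sum_(j | P j) x j * y j)).
  rewrite !big_distrlr /= mulr_sumr -big_split -sumrB /=.
  apply: eq_bigr => i _; rewrite mulr_sumr -big_split -sumrB /=.
  by apply: eq_bigr => j _; ring.
by set X := \sum_(i | P i) x i ^+ 2; set Y := \sum_(i | P i) y i ^+ 2; nra.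
Qed.

Lemma sqr_sum_le (x : I -> R) :
  (\sum_(i | P i) x i) ^+ 2 <= #|P|%:R * \sum_(i | P i) x i ^+ 2.
Proof.
have -> : #|P|%:R = \sum_(i | P i) 1 ^+ 2 :> R.
  by rewrite -sum1_card natr_sum; apply: eq_bigr => i _; rewrite expr1n.
by apply: le_trans (cauchy_schwarz (fun=> 1) x); under [in leRHS]eq_bigr do rewrite mul1r.
Qed.

End CauchySchwarz.

Section Isotropic.
Variables (F : finFieldType) (R : realType) (chi : F -> complex R).
Hypothesis qF : (#|F| %% 4 = 3)%N.
Hypothesis chiP : nontrivial_additive_character chi.

(* The sign of the Gauss sum makes the nonnegative sum over isotropic
   frequencies enter the right-hand side with a minus sign. *)
Lemma isotropic_pairsE k (A : {set 'rV[F]_(4 * k + 2)}) :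
  (#|F| ^ (2 * k + 1))%:R *
    (#|F|%:R * \sum_(a in A) \sum_(b in A) (dotv (a - b) (a - b) == 0)%:R - #|A|%:R ^+ 2) =
  (#|F| ^ (4 * k + 2))%:R * #|A|%:R -
    #|F|%:R * \sum_(x : 'rV[F]_(4 * k + 2)) (dotv x x == 0)%:R *
      cabs (\sum_a (a \in A)%:R * chi (dotv x a)) ^+ 2 :> R.
Proof.
set c := fun a : 'rV[F]_(4 * k + 2) => (a \in A)%:R : complex R.
have -> : (#|F| ^ (4 * k + 2))%:R * #|A|%:R =
    \sum_x cabs (\sum_a (a \in A)%:R * chi (dotv x a)) ^+ 2 :> R.
  rewrite (plancherel_inj chiP c (phi := id)) //; congr (_ * _).
  rewrite -sum1_card natr_sum big_mkcond; apply: eq_bigr => a _.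
  by rewrite cabs_nat; case: (a \in A); rewrite ?expr1n ?expr0n.
rewrite [in RHS]mulr_sumr -sumrB; apply: complexI.
have sqrA : (#|A|%:R ^+ 2 : R)%:C%C = #|A|%:R ^+ 2 by rewrite expr2 rmorphM /= rmorph_nat.
rewrite rmorphM rmorphB rmorphM !rmorph_nat /= sqrA rmorph_sum /=.
(* As the Gauss sum does not depend on s, the substitution t = -1/(4s) and orthogonality in t
   identify this sum with the left-hand side. *)
transitivity (- \sum_(s | s != 0) \sum_(a in A) \sum_(b in A)
    chi (- (4 * s)^-1 * dotv (a - b) (a - b)) * gauss chi (4 * k + 2) s).
  under [in RHS]eq_bigr => s s0.
    under eq_bigr => a _ do rewrite -mulr_suml.
    rewrite -mulr_suml gauss_3mod4 //; over.
  rewrite -mulr_suml mulrN opprK mulrC; congr (_ * _).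
  have -> : \sum_(s | s != 0) \sum_(a in A) \sum_(b in A)
      chi (- (4 * s)^-1 * dotv (a - b) (a - b)) =
      \sum_(t | t != 0) \sum_(a in A) \sum_(b in A) chi (t * dotv (a - b) (a - b)).
    rewrite [RHS](reindex (fun s => - (4 * s)^-1)) /=.
      by apply: eq_bigl => s; rewrite oppr_eq0 invr_eq0 mulf_eq0 (negPf (four_neq0 qF)).
    exists (fun s => - (4 * s)^-1) => s _;
      by rewrite mulrN invrN opprK invfM invrK mulKf ?four_neq0.
  set T := fun t => \sum_(a in A) \sum_(b in A) chi (t * dotv (a - b) (a - b)).
  have T0 : T 0 = #|A|%:R ^+ 2.
    rewrite /T; under eq_bigr => a _ do under eq_bigr => b _ do rewrite mul0r (chi0 chiP).
    by rewrite !sumr_const expr2 -[LHS]mulr_natr.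
  have -> : \sum_(t | t != 0) T t = \sum_t T t - #|A|%:R ^+ 2.
    by rewrite [in RHS](bigD1 0) //= T0 addrAC subrr add0r.
  congr (_ - _); rewrite /T [RHS]exchange_big mulr_sumr /=; apply: eq_bigr => a _ /=.
  rewrite [RHS]exchange_big rmorph_sum mulr_sumr /=; apply: eq_bigr => b _.
  by rewrite sum_chi // rmorph_nat mulrC.
(* Undoing the completion of the square brings in a frequency x, at which the double sum over A
   factors as a squared modulus. *)
transitivity (- \sum_(s | s != 0) \sum_(x : 'rV[F]_(4 * k + 2))
    chi (s * dotv x x) * (cabs (\sum_a c a * chi (dotv x a)) ^+ 2)%:C%C).
  congr (- _); apply: eq_bigr => s s0.
  under eq_bigr => a _ do under eq_bigr => b _ do rewrite -gauss_shift //.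
  under eq_bigr => a _ do rewrite exchange_big.
  rewrite exchange_big; apply: eq_bigr => x _ /=.
  have cE : \sum_a c a * chi (dotv x a) = \sum_(a in A) chi (dotv x a).
    rewrite [RHS]big_mkcond; apply: eq_bigr => a _.
    by rewrite /c; case: (a \in A); rewrite ?mul1r ?mul0r.
  rewrite cabs_sqr cE rmorph_sum big_distrlr [RHS]mulr_sumr; apply: eq_bigr => a _ /=.
  rewrite [RHS]mulr_sumr; apply: eq_bigr => b _.
  by rewrite -(chiN chiP) -!(chiD chiP) !dotvE.
rewrite exchange_big rmorph_sum -sumrN; apply: eq_bigr => x _ /=.
rewrite -mulr_suml rmorphB !rmorphM /= !rmorph_nat.
have -> : \sum_(s | s != 0) chi (s * dotv x x) = (dotv x x == 0)%:R * #|F|%:R - 1.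
  by rewrite -(sum_chi chiP) [in RHS](bigD1 0) //= mul0r (chi0 chiP) addrAC subrr add0r.
by rewrite mulrBl opprB mul1r mulrA (mulrC (#|F|%:R)).
Qed.

Lemma isotropic_pairs k (A : {set 'rV[F]_(4 * k + 2)}) :
  #|F|%:R * \sum_(a in A) \sum_(b in A) (dotv (a - b) (a - b) == 0)%:R <=
  #|A|%:R ^+ 2 + (#|F| ^ (2 * k + 1))%:R * #|A|%:R :> R.
Proof.
have q0 : 0 < (#|F| ^ (2 * k + 1))%:R :> R.
  by rewrite ltr0n expn_gt0 (ltn_trans _ (finNzRing_gt1 F)).
rewrite -lerBlDl -(ler_pM2l q0) isotropic_pairsE.
have -> : (#|F| ^ (4 * k + 2) = #|F| ^ (2 * k + 1) * #|F| ^ (2 * k + 1))%N.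
  by rewrite -expnD; congr expn; lia.
rewrite natrM -mulrA gerBl mulr_ge0 // sumr_ge0 // => x _.
by rewrite mulr_ge0 // sqr_ge0.
Qed.

End Isotropic.

(** * Incidences with hyperplanes *)

Section Hyperplanes.
Variables (F : finFieldType) (R : realType) (chi : F -> complex R).
Hypothesis chiP : nontrivial_additive_character chi.
Variable n : nat.

Lemma card_hyperplane (u : 'rV[F]_n) (h : F) : u != 0 ->
  #|F|%:R * \sum_b (dotv b u == h)%:R = (#|F| ^ n)%:R :> R.
Proof.
move=> u0; apply: complexI; rewrite rmorphM !rmorph_nat rmorph_sum mulr_sumr /=.
transitivity (\sum_t \sum_b chi (- t * h) * chi (dotv b (t *: u))).
  rewrite exchange_big; apply: eq_bigr => b _ /=.
  rewrite rmorph_nat mulrC -subr_eq0 -(sum_chi chiP); apply: eq_bigr => t _.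
  by rewrite -(chiD chiP) dotvZr; congr chi; ring.
under eq_bigr => t _ do rewrite -mulr_sumr sum_chi_dotv // scaler_eq0 (negPf u0) orbF.
rewrite (bigD1 0) //= big1 => [|t /negPf ->]; last by rewrite mul0r mulr0.
by rewrite eqxx oppr0 mul0r (chi0 chiP) !mul1r addr0.
Qed.

(** By independence of u and v only the pair s = t = 0 contributes: the two incidences behave as
    independent events of probability 1/q. *)
Lemma card_hyperplaneI (u v : 'rV[F]_n) (g h : F) :
  (forall s t, s *: u + t *: v = 0 -> s = 0 /\ t = 0) ->
  #|F|%:R ^+ 2 * \sum_b (dotv b u == g)%:R * (dotv b v == h)%:R = (#|F| ^ n)%:R :> R.
Proof.
move=> uv; apply: complexI; rewrite rmorphM rmorph_nat rmorph_sum mulr_sumr /=.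
transitivity (\sum_s \sum_t \sum_b
    chi (- s * g - t * h) * chi (dotv b (s *: u + t *: v))).
  under [RHS]eq_bigr => s _ do rewrite exchange_big.
  rewrite [RHS]exchange_big; apply: eq_bigr => b _ /=.
  rewrite expr2 !rmorphM !rmorph_nat /= mulrACA ![#|F|%:R * _]mulrC.
  rewrite -(subr_eq0 _ g) -(subr_eq0 _ h) -!(sum_chi chiP) mulr_suml.
  apply: eq_bigr => s _; rewrite mulr_sumr; apply: eq_bigr => t _.
  by rewrite -!(chiD chiP) dotvDr !dotvZr; congr chi; ring.
under eq_bigr => s _ do under eq_bigr => t _ do rewrite -mulr_sumr sum_chi_dotv //.
rewrite (bigD1 0) //= (bigD1 0) //= !scale0r addr0 eqxx !mul0r subr0 oppr0 mul0r.
rewrite (chi0 chiP) !mul1r !big1 ?addr0 // => [s s0|t t0].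
  by apply: big1 => t _; case: eqP => [/uv[/eqP]|]; rewrite ?(negPf s0) // mul0r mulr0.
by case: eqP => [e|]; rewrite ?mul0r ?mulr0 //; case: (uv 0 t) t0 => [|_ ->];
  rewrite ?scale0r ?eqxx.
Qed.

Variables (J : finType) (P : pred J) (u : J -> 'rV[F]_n) (h : J -> F).
Hypothesis u_neq0 : forall j, P j -> u j != 0.

(** For nonzero normals, proportional equations mean that the two hyperplanes coincide as point
    sets. *)
Definition same_hyperplane i j :=
  [exists l, (u j == l *: u i) && (h j == l * h i)].

(** Centred incidences with two transverse hyperplanes are uncorrelated, and with two distinct
    parallel ones negatively correlated. Only coincident pairs remain, each contributing at most
    q^(n+1). *)
Lemma hyperplane_second_moment :
  \sum_b (\sum_(j | P j) (#|F|%:R * (dotv b (u j) == h j)%:R - 1)) ^+ 2 <=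
  (#|F| ^ n.+1)%:R * \sum_(i | P i) \sum_(j | P j) (same_hyperplane i j)%:R :> R.
Proof.
under eq_bigr => b _ do rewrite expr2 big_distrlr /=.
rewrite exchange_big mulr_sumr; apply: ler_sum => i Pi /=.
rewrite exchange_big mulr_sumr; apply: ler_sum => j Pj /=.
have -> : \sum_b (#|F|%:R * (dotv b (u i) == h i)%:R - 1) *
    (#|F|%:R * (dotv b (u j) == h j)%:R - 1) =
    #|F|%:R ^+ 2 * \sum_b (dotv b (u i) == h i)%:R * (dotv b (u j) == h j)%:R
    - (#|F| ^ n)%:R :> R.
  have q1 : \sum_(b : 'rV[F]_n) 1 = (#|F| ^ n)%:R :> R.
    by rewrite sumr_const card_mx mul1n.
  transitivity (#|F|%:R ^+ 2 * \sum_b (dotv b (u i) == h i)%:R * (dotv b (u j) == h j)%:R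
      - #|F|%:R * (\sum_b (dotv b (u i) == h i)%:R)
      - #|F|%:R * (\sum_b (dotv b (u j) == h j)%:R) + \sum_(b : 'rV[F]_n) 1 : R).
    rewrite !mulr_sumr -!sumrB -big_split /=.
    by apply: eq_bigr => b _; ring.
  by rewrite !card_hyperplane ?u_neq0 // q1 subrK.
have q0 : 0 <= #|F|%:R :> R by [].
rewrite lerBlDr; case: (boolP (same_hyperplane i j)) => [_|nij].
  rewrite mulr1 expnS natrM -(card_hyperplane (h i) (u_neq0 Pi)) mulrA -expr2.
  rewrite -[leLHS]addr0 lerD ?mulr_ge0 ?sumr_ge0 // ler_wpM2l ?sqr_ge0 //.
  by apply: ler_sum => b _; rewrite ler_piMr // lern1 leq_b1.
(* First case: parallel and distinct, hence disjoint. Second case: independent normals. *)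
rewrite mulr0 add0r; case: (boolP [exists l, u j == l *: u i]) => [/existsP[l /eqP ul]|nl].
  rewrite big1 ?mulr0 // => b _; case: eqP => [bi|]; rewrite ?mul0r // mul1r.
  case: eqP => // bj; case/existsP: nij; exists l; rewrite ul eqxx /=.
  by rewrite -bi -bj ul dotvZr.
rewrite card_hyperplaneI // => s t st.
have t0 : t = 0.
  apply: contraNeq nl => t0; apply/existsP; exists (- (s / t)).
  move/eqP: st; rewrite addrC addr_eq0 => /eqP st.
  by rewrite -[u j](scalerK t0) st scalerN scaleNr scalerA mulrC.
by move/eqP: st; rewrite t0 scale0r addr0 scaler_eq0 (negPf (u_neq0 Pi)) orbF => /eqP.
Qed.

End Hyperplanes.

(** * Rectangles and additive energy *)

Section Lift.
Variables (F : finFieldType) (n : nat).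
Implicit Types (u y : 'rV[F]_n) (v : F) (m : 'rV[F]_n.+1).

Definition pcons u v : 'rV[F]_n.+1 := \row_i oapp (u 0) v (unlift ord_max i).

Definition phead m : 'rV[F]_n := \row_i m 0 (widen_ord (leqnSn n) i).

Definition plift y := pcons y (dotv y y).

Lemma widen_ord_lift (i : 'I_n) : widen_ord (leqnSn n) i = lift ord_max i.
Proof. by apply: val_inj; rewrite /= /bump leqNgt ltn_ord. Qed.

Lemma phead_pcons u v : phead (pcons u v) = u.
Proof. by apply/rowP => i; rewrite !mxE widen_ord_lift liftK. Qed.

Lemma pcons_last u v : pcons u v 0 ord_max = v.
Proof. by rewrite mxE unlift_none. Qed.

Lemma pcons_eta m : pcons (phead m) (m 0 ord_max) = m.
Proof.
apply/rowP => i; rewrite mxE; case: unliftP => [j ->|->] //=.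
by rewrite mxE widen_ord_lift.
Qed.

Lemma pheadD m1 m2 : phead (m1 + m2) = phead m1 + phead m2.
Proof. by apply/rowP => i; rewrite !mxE. Qed.

Lemma dotv_pcons m1 m2 :
  dotv m1 m2 = dotv (phead m1) (phead m2) + m1 0 ord_max * m2 0 ord_max.
Proof.
rewrite {1}/dotv big_ord_recr /=; congr (_ + _).
by apply: eq_bigr => i _; rewrite !mxE.
Qed.

Lemma plift_inj : injective plift.
Proof. by move=> x y /(congr1 phead); rewrite !phead_pcons. Qed.

Lemma paraboloidE : paraboloid F n = [set plift y | y : 'rV[F]_n].
Proof.
apply/setP => m; rewrite inE; apply/eqP/imsetP => [h|[y _ ->]].
  exists (phead m) => //; rewrite -[LHS]pcons_eta h; congr pcons.
  by apply: eq_bigr => i _; rewrite !mxE expr2.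
rewrite pcons_last; apply: eq_bigr => i _.
by rewrite mxE widen_ord_lift liftK expr2.
Qed.

Lemma card_paraboloid : #|paraboloid F n| = (#|F| ^ n)%N.
Proof. by rewrite paraboloidE card_imset ?card_mx ?mul1n //; apply: plift_inj. Qed.

Lemma sum_paraboloid (V : nmodType) (f : 'rV[F]_n.+1 -> V) :
  \sum_(x in paraboloid F n) f x = \sum_y f (plift y).
Proof.
by rewrite paraboloidE big_imset //= => x y _ _ /plift_inj.
Qed.

(** The first coordinates make a, c, b, e a parallelogram; the equality of norms then makes a - c
    and b - c orthogonal, so it is a rectangle. *)
Lemma plift_add_eq (a b c e : 'rV[F]_n) : (2 : F) != 0 ->
  plift a + plift b = plift c + plift e ->
  e = a + b - c /\ dotv b (a - c) = dotv c (a - c).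
Proof.
move=> two h; have := congr1 phead h; have := congr1 (fun m => m 0 ord_max) h.
rewrite !pheadD !phead_pcons !mxE unlift_none /= => h1 h2.
have -> : e = a + b - c by rewrite h2 addrAC subrr add0r.
split => //; move: h1; have -> : e = a + b - c by rewrite h2 addrAC subrr add0r.
rewrite !dotvE (dotvC b a) (dotvC c a) (dotvC c b) => h1.
apply: (mulfI two); apply/eqP; rewrite -subr_eq0; apply/eqP.
by rewrite -(subrr (dotv a a + dotv b b)) {1}h1; ring.
Qed.

End Lift.

(** * Right angles with a nonisotropic leg *)

Section Triples.
Variables (F : finFieldType) (R : realType) (chi : F -> complex R).
Hypothesis chiP : nontrivial_additive_character chi.
Variables (n : nat) (A : {set 'rV[F]_n}).

Definition nonisotropic (p : 'rV[F]_n * 'rV[F]_n) :=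
  [&& p.1 \in A, p.2 \in A & dotv (p.1 - p.2) (p.1 - p.2) != 0].
(** For p = (a, c), [chord] and [chord_level] describe the hyperplane through c normal to a - c: its
    points b are those with a right angle at c. *)
Definition chord (p : 'rV[F]_n * 'rV[F]_n) := p.1 - p.2.
Definition chord_level (p : 'rV[F]_n * 'rV[F]_n) := dotv p.2 (p.1 - p.2).

Lemma nonisotropic_card : \sum_(p | nonisotropic p) 1 <= #|A|%:R ^+ 2 :> R.
Proof.
apply: (@le_trans _ _ (\sum_(p | (p.1 \in A) && (p.2 \in A)) 1)).
  rewrite big_mkcond [leRHS]big_mkcond /=; apply: ler_sum => p _.
  by rewrite /nonisotropic; case: (p.1 \in A); case: (p.2 \in A) => //=; case: ifP.
rewrite -(pair_big (mem A) (mem A) (fun _ _ => 1 : R)) /= !sumr_const.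
by rewrite expr2 -[leLHS]mulr_natr.
Qed.

(* In a nonisotropic direction the hyperplane and a point off it determine the
   foot of the perpendicular. *)
Lemma same_hyperplane_card p : nonisotropic p ->
  \sum_(r | nonisotropic r) (same_hyperplane chord chord_level p r)%:R <= #|A|%:R :> R.
Proof.
case/and3P => _ _ p0.
(* The orthogonal projection of a to the hyperplane of p; the denominator is nonzero because p is
   nonisotropic. *)
pose foot a := a - ((dotv a (chord p) - chord_level p) / dotv (chord p) (chord p)) *: chord p.
apply: (@le_trans _ _ (\sum_(a in A) \sum_c (c == foot a)%:R)); last first.
  rewrite -sum1_card natr_sum; apply: ler_sum => a _.
  by rewrite (bigD1 (foot a)) //= eqxx big1 ?addr0 // => c /negPf ->.
rewrite (pair_big (mem A) xpredT (fun a c => (c == foot a)%:R)) /=.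
rewrite big_mkcond [leRHS]big_mkcond /=; apply: ler_sum => -[a c] _.
rewrite /nonisotropic /=; case: (a \in A) => //=; case: (c \in A) => //=.
case: ifP => //= ac0; rewrite ler_nat; case: (boolP (same_hyperplane _ _ _ _)) => //.
case/existsP => l /andP[/eqP]; rewrite {1}/chord /= => acE.
rewrite /chord_level /= acE dotvZr => /eqP/mulfI h.
have l0 : l != 0 by apply/eqP => l0; move: ac0; rewrite acE l0 scale0r dotv0l eqxx.
have {h} := h l0; rewrite -/(chord p) => h.
have -> : c = foot a; last by rewrite eqxx.
have aE : a = c + l *: chord p by rewrite -acE addrC subrK.
by rewrite /foot /chord_level aE dotvDl dotvZl h -/(chord p) (addrC (dotv p.2 _)) addrK mulfK // addrK.
Qed.

(** The mean number of incidences gives |A|^3. The deviation is bounded by Cauchy-Schwarz over b in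
    A and the second moment, in which each hyperplane repeats at most |A| times. Here w =
    q^((n+1)/2). *)
Lemma nonisotropic_triples (w : R) : 0 <= w -> w ^+ 2 = (#|F| ^ n.+1)%:R ->
  #|F|%:R * \sum_(p | nonisotropic p) \sum_(b in A) (dotv b (chord p) == chord_level p)%:R <=
  #|A|%:R ^+ 3 + w * #|A|%:R ^+ 2.
Proof.
move=> w0 wE.
pose phi b : R := \sum_(p | nonisotropic p) (#|F|%:R * (dotv b (chord p) == chord_level p)%:R - 1).
have -> : #|F|%:R * \sum_(p | nonisotropic p) \sum_(b in A) (dotv b (chord p) == chord_level p)%:R =
    #|A|%:R * (\sum_(p | nonisotropic p) 1) + \sum_(b in A) phi b.
  rewrite [X in _ = _ + X]exchange_big !mulr_sumr -big_split; apply: eq_bigr => p _ /=.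
  by rewrite sumrB mulr_sumr sumr_const mulr1 addrC subrK.
rewrite lerD //; first by rewrite exprS ler_wpM2l // nonisotropic_card.
have chord_neq0 p : nonisotropic p -> chord p != 0.
  by case/and3P => _ _; apply: contraNneq; rewrite /chord => ->; rewrite dotv0l.
have phi2 : (\sum_(b in A) phi b) ^+ 2 <= (w * #|A|%:R ^+ 2) ^+ 2.
  apply: (le_trans (sqr_sum_le _ _)).
  rewrite exprMn wE -exprM (_ : (#|F| ^ n.+1)%:R * #|A|%:R ^+ (2 * 2) =
    #|A|%:R * ((#|F| ^ n.+1)%:R * (#|A|%:R ^+ 2 * #|A|%:R))); last by ring.
  rewrite ler_wpM2l //.
  apply: (@le_trans _ _ (\sum_b phi b ^+ 2)).
    by rewrite big_mkcond; apply: ler_sum => b _; case: ifP => // _; rewrite sqr_ge0.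
  apply: (le_trans (hyperplane_second_moment chiP _ chord_neq0)).
  rewrite ler_wpM2l //.
  apply: le_trans (_ : \sum_(p | nonisotropic p) (1 * #|A|%:R) <= _).
    by apply: ler_sum => p Pp; rewrite mul1r same_hyperplane_card.
  by rewrite -mulr_suml ler_wpM2r // nonisotropic_card.
apply: le_trans (ler_norm _) _.
by rewrite -ler_sqr ?nnegrE ?normr_ge0 ?mulr_ge0 ?exprn_ge0 // real_normK ?num_real.
Qed.

End Triples.

(** * Additive energy of subsets of the paraboloid *)

Section Energy.
Variables (F : finFieldType) (R : realType) (chi : F -> complex R).
Hypothesis qF : (#|F| %% 4 = 3)%N.
Hypothesis chiP : nontrivial_additive_character chi.

Definition energy n (A : {set 'rV[F]_n}) : R :=
  \sum_(p | (p.1 \in A) && (p.2 \in A)) \sum_(r | (r.1 \in A) && (r.2 \in A))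
    (plift p.1 + plift p.2 == plift r.1 + plift r.2)%:R.

(** The fourth vertex of a rectangle is a + b - c, so it is enough to count right-angled corners. *)
Lemma energy_le_triples n (A : {set 'rV[F]_n}) :
  energy A <= \sum_(p | (p.1 \in A) && (p.2 \in A))
    \sum_(b in A) (dotv b (chord p) == chord_level p)%:R.
Proof.
rewrite -(pair_big (mem A) (mem A)
  (fun a c => \sum_(b in A) (dotv b (a - c) == dotv c (a - c))%:R)) /=.
rewrite /energy -(pair_big (mem A) (mem A) (fun a b =>
  \sum_(r | (r.1 \in A) && (r.2 \in A)) (plift a + plift b == plift r.1 + plift r.2)%:R)) /=.
apply: ler_sum => a _; rewrite [leRHS]exchange_big; apply: ler_sum => b _ /=.
rewrite -(pair_big (mem A) (mem A) (fun c e =>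
  (plift a + plift b == plift c + plift e)%:R)) /=.
apply: ler_sum => c _.
apply: (@le_trans _ _ (\sum_e (dotv b (a - c) == dotv c (a - c))%:R * (e == a + b - c)%:R)).
  rewrite big_mkcond; apply: ler_sum => e _; case: ifP => // _; last by rewrite mulr_ge0.
  case: eqP => [/(plift_add_eq (two_neq0 qF))[-> ->]|_]; first by rewrite !eqxx mulr1.
  by rewrite mulr_ge0.
by rewrite -mulr_sumr (bigD1 (a + b - c)) //= eqxx big1 ?addr0 ?mulr1 // => e /negPf ->.
Qed.

Lemma energy_le k (A : {set 'rV[F]_(4 * k + 2)}) (w : R) :
  0 <= w -> w ^+ 2 = (#|F| ^ (4 * k + 3))%:R ->
  #|F|%:R * energy A <= 2 * #|A|%:R ^+ 3 + 2 * w * #|A|%:R ^+ 2.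
Proof.
move=> w0 wE.
have wE' : w ^+ 2 = (#|F| ^ (4 * k + 2).+1)%:R by rewrite wE -addnS.
apply: (le_trans (ler_wpM2l _ (energy_le_triples A))) => //.
rewrite (bigID (fun p => dotv (p.1 - p.2) (p.1 - p.2) == 0)) /= mulrDr.
have -> : 2 * #|A|%:R ^+ 3 + 2 * w * #|A|%:R ^+ 2 =
  (#|A|%:R ^+ 2 + w * #|A|%:R) * #|A|%:R + (#|A|%:R ^+ 3 + w * #|A|%:R ^+ 2) :> R by ring.
apply: lerD; last first.
  rewrite (eq_bigl (nonisotropic A)) => [|p]; last by rewrite -andbA.
  exact: (nonisotropic_triples chiP).
(* For an isotropic chord every b in A is allowed, at the cost of a factor |A|; moreover q^(2k+1) <=
   w = q^((4k+3)/2). *)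
apply: (@le_trans _ _ ((#|A|%:R ^+ 2 + (#|F| ^ (2 * k + 1))%:R * #|A|%:R) * #|A|%:R)); last first.
  rewrite ler_wpM2r // lerD2l ler_wpM2r // -ler_sqr ?nnegrE // wE -natrX -expnM ler_nat.
  by rewrite leq_pexp2l ?(ltn_trans _ (finNzRing_gt1 F)) //; lia.
apply: le_trans (ler_wpM2r _ (isotropic_pairs qF chiP A)) => //.
rewrite -mulrA ler_wpM2l // mulr_suml.
under [leRHS]eq_bigr => a _ do rewrite mulr_suml.
rewrite [leRHS](pair_big (mem A) (mem A)
  (fun a b => (dotv (a - b) (a - b) == 0)%:R * #|A|%:R)) /=.
rewrite big_mkcondr; apply: ler_sum => p _.
case: ifP => _; last by rewrite mul0r.
rewrite mul1r -sum1_card natr_sum; apply: ler_sum => b _.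
by rewrite lern1 leq_b1.
Qed.

End Energy.

(** * Restriction to the paraboloid *)

Section Kernel.
Variables (F : finFieldType) (R : realType) (chi : F -> complex R).
Hypothesis qF : (#|F| %% 4 = 3)%N.
Hypothesis chiP : nontrivial_additive_character chi.
Variable n : nat.

Lemma cabs_gauss s : s != 0 -> cabs (gauss chi n s) ^+ 2 = (#|F| ^ n)%:R.
Proof.
move=> s0; rewrite gaussX // cabsX -exprM mulnC exprM natrX; congr (_ ^+ _).
by apply: complexI; rewrite cabs_sqr gauss1_norm // rmorph_nat.
Qed.

(** The Fourier transform of the counting measure on the paraboloid. *)
Definition kernel (m : 'rV[F]_n.+1) : complex R := \sum_y chi (dotv m (plift y)).

Lemma kernelE (m : 'rV[F]_n.+1) : m 0 ord_max != 0 ->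
  kernel m = chi (- (4 * m 0 ord_max)^-1 * dotv (phead m) (phead m)) * gauss chi n (m 0 ord_max).
Proof.
move=> m0; rewrite -gauss_shift //; apply: eq_bigr => y _; congr chi.
by rewrite dotv_pcons phead_pcons pcons_last addrC dotvC.
Qed.

(** At height 0 the quadratic phase disappears, leaving a point mass at the origin. *)
Lemma kernel_flat (m : 'rV[F]_n.+1) : m 0 ord_max = 0 -> kernel m = (m == 0)%:R * (#|F| ^ n)%:R.
Proof.
move=> m0; have -> : (m == 0) = (phead m == 0).
  apply/eqP/eqP => [->|h]; first by apply/rowP => i; rewrite !mxE.
  rewrite -(pcons_eta m) m0 h; apply/rowP => i; rewrite !mxE.
  by case: unlift => //= j; rewrite mxE.
rewrite -(sum_chi_dotv chiP); apply: eq_bigr => y _; congr chi.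
by rewrite dotv_pcons m0 mul0r addr0 phead_pcons dotvC.
Qed.

Lemma sum_pcons (V : nmodType) (f : 'rV[F]_n.+1 -> V) :
  \sum_m f m = \sum_s \sum_y f (pcons y s).
Proof.
rewrite exchange_big pair_big /= (reindex (fun m => (phead m, m 0 ord_max))) /=.
  by apply: eq_bigr => m _; rewrite pcons_eta.
exists (fun p => pcons p.1 p.2) => [m _|[u v] _] /=; first exact: pcons_eta.
by rewrite phead_pcons pcons_last.
Qed.

Variables (E : {set 'rV[F]_n.+1}) (omega : 'rV[F]_n.+1 -> complex R).
Hypothesis omega1 : forall m, cabs (omega m) = 1.

Definition slice s : {set 'rV[F]_n} := [set y | pcons y s \in E].

Lemma card_slices : #|E|%:R = \sum_s #|slice s|%:R :> R.
Proof.
rewrite -sum1_card natr_sum big_mkcond sum_pcons; apply: eq_bigr => s _.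
rewrite -sum1_card natr_sum [RHS]big_mkcond; apply: eq_bigr => y _.
by rewrite inE.
Qed.

(** An unnormalised extension from the lifted slice; the coefficients are conjugated because they
    come from the conjugate factor of a squared modulus. *)
Definition slice_sum s (w : 'rV[F]_n.+1) : complex R :=
  \sum_y (y \in slice s)%:R * (omega (pcons y s))^*%C * chi (dotv w (plift y)).

(* The convolution with the kernel of a function on the hyperplane at height
   [s] is, up to a unimodular factor, an extension operator evaluated here. *)
Definition slice_point s (m : 'rV[F]_n.+1) : 'rV[F]_n.+1 :=
  let t := m 0 ord_max - s in pcons ((2 * t)^-1 *: phead m) (- (4 * t)^-1).

(** Injectivity lets a sum over m be bounded by the sum over all frequencies. *)
Lemma slice_point_inj s (m1 m2 : 'rV[F]_n.+1) : m1 0 ord_max != s -> m2 0 ord_max != s ->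
  slice_point s m1 = slice_point s m2 -> m1 = m2.
Proof.
rewrite -subr_eq0 -(subr_eq0 (m2 0 _)) => t1 t2 e.
have := congr1 (fun m : 'rV[F]_n.+1 => m 0 ord_max) e.
rewrite !pcons_last => /oppr_inj/invr_inj/(mulfI (four_neq0 qF)) t12.
have := congr1 (@phead F n) e; rewrite !phead_pcons t12 => /scalerI h.
rewrite -(pcons_eta m1) -(pcons_eta m2) h ?invr_eq0 ?mulf_neq0 ?two_neq0 //.
by rewrite (addIr _ t12).
Qed.

(** In the phase of the kernel at (m - y), the square of m factors out; the cross term and the
    square of y are the pairing of [slice_point] with the lift of y. *)
Lemma kernel_slice (gam : R) s (m : 'rV[F]_n.+1) : 0 <= gam -> gam ^+ 2 = (#|F| ^ n)%:R ->
  m 0 ord_max != s ->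
  cabs (\sum_y (y \in slice s)%:R * (omega (pcons y s))^*%C * kernel (m - pcons y s)) =
  gam * cabs (slice_sum s (slice_point s m)).
Proof.
move=> gam0 gamE ms; have t0 : m 0 ord_max - s != 0 by rewrite subr_eq0.
set t := m 0 ord_max - s in t0.
rewrite (_ : \sum_y _ = gauss chi n t * (chi (- (4 * t)^-1 * dotv (phead m) (phead m)) *
    slice_sum s (slice_point s m))); last first.
  rewrite /slice_sum [X in _ = _ * X]mulr_sumr [RHS]mulr_sumr; apply: eq_bigr => y _.
  have tE : (m - pcons y s) 0 ord_max = t by rewrite !mxE unlift_none.
  have hE : phead (m - pcons y s) = phead m - y.
    by apply/rowP => i; rewrite !mxE widen_ord_lift liftK.
  rewrite kernelE tE // hE [RHS]mulrCA [in RHS]mulrCA [LHS]mulrA [LHS]mulrC; congr (_ * _).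
  rewrite mulrCA; congr (_ * _).
  rewrite dotv_pcons /slice_point !phead_pcons !pcons_last -/t -(chiD chiP); congr chi.
  rewrite !dotvE (dotvC y); field.
  by rewrite four_neq0 // two_neq0 // t0.
rewrite !cabsM (cabs_chi chiP) mul1r; congr (_ * _).
by apply/eqP; rewrite -(@eqrXn2 _ 2) ?cabs_ge0 // cabs_gauss // gamE.
Qed.

(** Expanding the square and summing over y first produces the kernel at differences of points of E.
    The second point is then grouped by its height s. *)
Lemma sum_sqr_paraboloid_le (gam : R) : 0 <= gam -> gam ^+ 2 = (#|F| ^ n)%:R ->
  \sum_y cabs (\sum_(m in E) omega m * chi (dotv m (plift y))) ^+ 2 <=
  (#|F| ^ n)%:R * #|E|%:R + gam * \sum_s \sum_(m in E | m 0 ord_max != s)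
    cabs (slice_sum s (slice_point s m)).
Proof.
move=> gam0 gamE.
pose I m s := \sum_y (y \in slice s)%:R * (omega (pcons y s))^*%C * kernel (m - pcons y s).
rewrite -[leLHS]cabs_real ?sumr_ge0 // => [|y _]; last by rewrite sqr_ge0.
have -> : (\sum_y cabs (\sum_(m in E) omega m * chi (dotv m (plift y))) ^+ 2)%:C%C =
    \sum_(m in E) omega m * \sum_s I m s.
  rewrite rmorph_sum /=.
  under eq_bigr => y _ do rewrite cabs_sqr rmorph_sum big_distrlr.
  rewrite exchange_big; apply: eq_bigr => m _ /=.
  rewrite exchange_big mulr_sumr /= big_mkcond sum_pcons; apply: eq_bigr => s _.
  rewrite [RHS]mulr_sumr; apply: eq_bigr => y _; rewrite inE.
  case: (pcons y s \in E); last by rewrite !mul0r mulr0.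
  rewrite mul1r mulrA mulr_sumr; apply: eq_bigr => z _.
  by rewrite rmorphM /= mulrACA -(chiN chiP) -(chiD chiP) dotvDl dotvNl.
apply: (le_trans (cabs_sum _ _ _)).
have -> : (#|F| ^ n)%:R * #|E|%:R = \sum_(m in E) (#|F| ^ n)%:R :> R.
  by rewrite sumr_const mulr_natr.
have -> : \sum_s \sum_(m in E | m 0 ord_max != s) cabs (slice_sum s (slice_point s m)) =
    \sum_(m in E) \sum_(s | m 0 ord_max != s) cabs (slice_sum s (slice_point s m)).
  rewrite (exchange_big_dep (mem E)) //=; last by move=> ? ? _ /andP[].
  by apply: eq_bigr => m mE; apply: eq_bigl => s; rewrite mE.
rewrite mulr_sumr -big_split; apply: ler_sum => m mE /=.
rewrite cabsM omega1 mul1r; apply: (le_trans (cabs_sum _ _ _)).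
(* On the slice at the height of m the kernel is a point mass, so only m itself contributes. *)
rewrite (bigD1 (m 0 ord_max)) //=; apply: lerD.
  rewrite /I (bigD1 (phead m)) //= big1 ?addr0 => [|y ym].
    rewrite pcons_eta subrr kernel_flat ?mxE // eqxx !cabsM !cabs_nat cabsJ omega1.
    by rewrite !mulr1 mul1r ler_piMl // lern1 leq_b1.
  rewrite kernel_flat ?mxE ?unlift_none ?subrr // subr_eq0.
  rewrite (_ : (m == _) = false) ?mul0r ?mulr0 //; apply/eqP => h.
  by move/eqP: ym; apply; rewrite h phead_pcons.
rewrite mulr_sumr (eq_bigl (fun s => m 0 ord_max != s)) => [|s]; last by rewrite eq_sym.
by apply: ler_sum => s ms; rewrite /I (kernel_slice gam0).
Qed.

(** The square of the slice sum is an exponential sum over pairs; Plancherel counts the coincidences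
    of their sums. *)
Lemma slice_sum4 s :
  \sum_w cabs (slice_sum s w) ^+ 4 <= (#|F| ^ n.+1)%:R * energy R (slice s).
Proof.
pose c (y : 'rV[F]_n) := (y \in slice s)%:R * (omega (pcons y s))^*%C.
have c_le p : cabs (c p.1 * c p.2) <= ((p.1 \in slice s) && (p.2 \in slice s))%:R.
  rewrite !cabsM !cabsJ !omega1 !mulr1 !cabs_nat.
  by case: (_ \in _); case: (_ \in _); rewrite ?mulr1 ?mulr0.
apply: le_trans (plancherel_le chiP (fun p => plift p.1 + plift p.2) c_le).
apply: ler_sum => w _; rewrite (exprM _ 2 2) [cabs _ ^+ 2]expr2 -cabsM big_distrlr pair_big /=.
rewrite (eq_bigr (fun p => c p.1 * c p.2 * chi (dotv w (plift p.1 + plift p.2)))) // => p _.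
by rewrite dotvDr (chiD chiP) mulrACA.
Qed.

(** Hölder with exponents 4/3 and 4, done as two applications of Cauchy-Schwarz. *)
Lemma slice_holder s :
  (\sum_(m in E | m 0 ord_max != s) cabs (slice_sum s (slice_point s m))) ^+ 4 <=
  #|E|%:R ^+ 3 * ((#|F| ^ n.+1)%:R * energy R (slice s)).
Proof.
set P := fun m : 'rV[F]_n.+1 => (m \in E) && (m 0 ord_max != s).
pose x m := cabs (slice_sum s (slice_point s m)).
have PE : #|P|%:R <= #|E|%:R :> R.
  by rewrite ler_nat; apply/subset_leq_card/subsetP => m /andP[].
have h4 : \sum_(m | P m) x m ^+ 4 <= (#|F| ^ n.+1)%:R * energy R (slice s).
  apply: le_trans (slice_sum4 s).
  rewrite -(big_imset (h := slice_point s) (A := P) (fun w => cabs (slice_sum s w) ^+ 4)) /=.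
    by rewrite big_mkcond; apply: ler_sum => w _; case: ifP => // _; rewrite exprn_ge0 ?cabs_ge0.
  by move=> m1 m2 /andP[_ h1] /andP[_ h2]; apply: slice_point_inj.
have h1 : (\sum_(m | P m) x m) ^+ 2 <= #|E|%:R * \sum_(m | P m) x m ^+ 2.
  apply: (le_trans (sqr_sum_le _ _)); apply: ler_wpM2r => //.
  by apply: sumr_ge0 => m _; rewrite sqr_ge0.
have h2 : (\sum_(m | P m) x m ^+ 2) ^+ 2 <= #|E|%:R * \sum_(m | P m) x m ^+ 4.
  apply: (le_trans (sqr_sum_le _ _)).
  under eq_bigr => m _ do rewrite -exprM.
  by apply: ler_wpM2r => //; apply: sumr_ge0 => m _; rewrite exprn_ge0 ?cabs_ge0.
have s0 : 0 <= \sum_(m | P m) x m ^+ 2 by apply: sumr_ge0 => m _; rewrite sqr_ge0.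
rewrite (exprM _ 2 2) -/P.
apply: (@le_trans _ _ ((#|E|%:R * \sum_(m | P m) x m ^+ 2) ^+ 2)).
  by rewrite ler_sqr ?nnegrE ?sqr_ge0 ?mulr_ge0.
rewrite exprMn (exprSr _ 2) -mulrA ler_wpM2l ?sqr_ge0 //.
by apply: (le_trans h2); rewrite ler_wpM2l.
Qed.

End Kernel.

(** * Summation over dyadic levels *)

Section Dyadic.
Variable R : realType.

Lemma powR2D (x e : R) : 0 <= x -> 0 < e -> powR x (2 + e) = x ^+ 2 * powR x e.
Proof.
move=> x0 e0; rewrite powRD; first by rewrite powR_mulrn.
by rewrite gt_eqF // addr_gt0.
Qed.

Lemma ler_cube (x y : R) : 0 <= y -> x ^+ 3 <= y ^+ 3 -> x <= y.
Proof.
move=> y0; rewrite leNgt => h; rewrite leNgt; apply: contra h => yx.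
by rewrite ltr_pXn2r ?nnegrE // (le_trans y0 (ltW yx)).
Qed.

Lemma exists_dyadic (L : R) : 1 <= L ->
  exists I, 2 ^+ I <= L /\ L < 2 ^+ I.+1.
Proof.
move=> L1; have ex : exists n, L < 2 ^+ n.
  exists (Num.bound L); apply: lt_trans (archi_boundP (le_trans ler01 L1)) _.
  by rewrite -natrX ltr_nat ltn_expl.
case: (ex_minnP ex) => -[|I] LI Imin; first by move: LI; rewrite expr0 ltNge L1.
by exists I; split => //; rewrite leNgt; apply/negP => /Imin; rewrite ltnn.
Qed.

(* Some term on the right-hand side of the last hypothesis is at least a third of its sum. *)
Lemma level_weight_le (x t y B Q : R) : 1 <= x -> 0 < t -> 0 < Q -> 0 <= y -> 0 <= B ->
  B ^+ 3 * x ^+ 2 = y ^+ 3 ->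
  x ^+ 2 * t ^+ 4 * Q <= 1 + 2 * Q * t ^+ 2 + 2 * Q * t ->
  y * x ^+ 2 * t ^+ 4 <= 3 * y / Q + 36 * B.
Proof.
move=> x1 t0 Q0 y0 B0 BE h.
have x0 : 0 < x by lra.
(* B is y / x^(2/3); cubing avoids the fractional power, and 36^3 = 6^6 is what the second case
   below yields. *)
have cube_bound : (y * x ^+ 2 * t ^+ 4) ^+ 3 * x ^+ 2 <= 36 ^+ 3 * y ^+ 3 ->
    y * x ^+ 2 * t ^+ 4 <= 3 * y / Q + 36 * B.
  move=> hZ; apply: (@le_trans _ _ (36 * B)); last by rewrite lerDr divr_ge0 ?mulr_ge0 // ltW.
  apply: ler_cube; first by rewrite mulr_ge0.
  by rewrite -(ler_pM2r (exprn_gt0 2 x0)) (le_trans hZ) // -BE mulrA -exprMn.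
have [h1|h1] := leP (x ^+ 2 * t ^+ 4 * Q) 3.
  apply: (@le_trans _ _ (3 * y / Q)); last by rewrite lerDl mulr_ge0.
  rewrite ler_pdivlMr // (_ : _ * Q = y * (x ^+ 2 * t ^+ 4 * Q)); last by ring.
  by rewrite (mulrC 3) ler_wpM2l.
have x21 : 1 <= x ^+ 2 by rewrite exprn_ege1.
have y30 : 0 <= y ^+ 3 by rewrite exprn_ge0.
have Qt2 : 0 < Q * t by rewrite mulr_gt0.
(* Second term dominant: the sixth power of this bound suffices, as [1 <= x] raises x^8 to x^12. *)
apply: cube_bound; have [h2|h2] := leP (x ^+ 2 * t ^+ 2) 6.
  have {}h2 : (x ^+ 2 * t ^+ 2) ^+ 6 <= 6 ^+ 6.
    by rewrite lerXn2r ?nnegrE // mulr_ge0 ?exprn_ge0 ?ltW.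
  rewrite (_ : _ * x ^+ 2 = y ^+ 3 * (x ^+ 8 * t ^+ 12)); last by ring.
  rewrite mulrC ler_wpM2r //.
  apply: (@le_trans _ _ (x ^+ 12 * t ^+ 12)).
    by rewrite ler_wpM2r ?exprn_ge0 ?(ltW t0) // ler_weXn2l.
  by rewrite (_ : _ * _ = (x ^+ 2 * t ^+ 2) ^+ 6) ?(le_trans h2) //; [lra|ring].
(* The first two terms are each below a third of the left-hand side, so the last one is at least a
   third. *)
have h3 : x ^+ 2 * t ^+ 3 <= 6.
  rewrite -(ler_pM2r Qt2); nra.
have {}h3 : (x ^+ 2 * t ^+ 3) ^+ 4 <= 6 ^+ 4.
  by rewrite lerXn2r ?nnegrE // mulr_ge0 ?exprn_ge0 ?ltW.
rewrite (_ : _ * x ^+ 2 = y ^+ 3 * (x ^+ 2 * t ^+ 3) ^+ 4); last by ring.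
rewrite mulrC ler_wpM2r // (le_trans h3) //; lra.
Qed.

Lemma powR_exp2 (e : R) i : powR (2 ^+ i) e = powR 2 e ^+ i.
Proof. by elim: i => [|i IH]; rewrite ?expr0 ?powR1 // !exprS powRM ?exprn_ge0 // IH. Qed.

(** The 1 accounts for values up to 1, the factor 2^(2+e) for rounding down to a power of 2, and the
    two fractions for a growing and a decaying geometric series. *)
Definition dyadic_bound (e : R) : R :=
  1 + powR 2 (2 + e) *
    (3 * powR 2 e / (powR 2 e - 1) + 36 / (1 - powR 2 (e - 2 / 3))).

(** The scaling puts the critical level at 1. Below it the square sum suffices. Above it, the weight
    of level 2^i has a part growing like 2^(ie), stopped at L, and a part decaying because e < 2/3.
    In [levels], t^4 is the size of E relative to L^2 Q. *)
Lemma dyadic_sum (e : R) (T : finType) (psi : T -> R) (L Q : R) :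
  0 < e -> e < 2 / 3 -> 1 <= L -> Q = powR L e ->
  (forall m, 0 <= psi m) -> (forall m, psi m <= L) ->
  \sum_m psi m ^+ 2 <= L ^+ 2 * Q ->
  (forall (x t : R) (E : {set T}), 0 < x -> 0 < t -> #|E|%:R = L ^+ 2 * Q * t ^+ 4 ->
     (forall m, m \in E -> x <= psi m) ->
     x ^+ 2 * t ^+ 4 * Q <= 1 + 2 * Q * t ^+ 2 + 2 * Q * t) ->
  \sum_m powR (psi m) (2 + e) <= dyadic_bound e * (L ^+ 2 * Q).
Proof.
move=> e0 e23 L1 QE psi0 psiL psi2 levels.
have L0 : 0 < L by apply: lt_le_trans L1.
have Q0 : 0 < Q by rewrite QE powR_gt0.
have r0 : 0 <= 2 + e by rewrite addr_ge0 // ltW.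
have LQ0 : 0 < L ^+ 2 * Q by rewrite mulr_gt0 // exprn_gt0.
set a := powR 2 e; set b := powR 2 (e - 2 / 3).
have powR_gt1 s : 0 < s -> 1 < powR 2 s :> R.
  move=> s0; have := @gt0_ltr_powR _ _ s0 1 2; rewrite powR1 !nnegrE.
  by apply; rewrite ?ler01 ?ler0n ?ltr1n.
have a1 : 1 < a by rewrite powR_gt1.
have b0 : 0 <= b by rewrite powR_ge0.
have b1 : b < 1.
  by rewrite /b -opprB powRN invf_lt1 ?powR_gt0 // powR_gt1 // subr_gt0.
have a0 : 0 < a by apply: lt_trans a1.
(* The relation between B and y in [level_weight_le], to be raised to the power i. *)
have ba : b ^+ 3 * 2 ^+ 2 = a ^+ 3.
  rewrite -!powR_mulrn ?(ltW a0) // /a /b -!powRrM -powRD; last by rewrite pnatr_eq0 implybT.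
  by congr powR; field.
have [I [IL LI]] := exists_dyadic L1.
pose E i := [set m | 2 ^+ i <= psi m].
have pointwise m : powR (psi m) (2 + e) <= psi m ^+ 2 +
    \sum_(i < I.+1) (m \in E i)%:R * (powR 2 (2 + e) * ((2 ^+ i) ^+ 2 * a ^+ i)).
  have term0 (i : 'I_I.+1) : 0 <= (m \in E i)%:R * (powR 2 (2 + e) * ((2 ^+ i) ^+ 2 * a ^+ i)).
    by rewrite !mulr_ge0 ?powR_ge0 ?exprn_ge0 ?(ltW a0).
  have [psi1|psi1] := leP (psi m) 1.
    apply: (@le_trans _ _ (psi m ^+ 2)); last by rewrite lerDl sumr_ge0.
    rewrite powR2D // ler_piMr ?exprn_ge0 //.
    have : powR (psi m) e <= powR 1 e by rewrite ge0_ler_powR ?nnegrE // ltW.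
    by rewrite powR1.
  have [i [ipsi psii]] := exists_dyadic (ltW psi1).
  have iI : (i < I.+1)%N.
    have : (2 : R) ^+ i < 2 ^+ I.+1 by apply: le_lt_trans LI; apply: le_trans (psiL m).
    by rewrite ltr_eXn2l ?ltr1n.
  apply: (@le_trans _ _ (powR (2 ^+ i.+1) (2 + e))).
    by rewrite ge0_ler_powR ?nnegrE ?exprn_ge0 // ltW.
  rewrite (bigD1 (Ordinal iI)) //= inE ipsi mul1r.
  rewrite (_ : powR (2 ^+ i.+1) (2 + e) = powR 2 (2 + e) * ((2 ^+ i) ^+ 2 * a ^+ i)).
    rewrite addrCA lerDl addr_ge0 ?exprn_ge0 // sumr_ge0 // => j _; exact: term0.
  by rewrite exprS powRM ?exprn_ge0 // (powR2D (exprn_ge0 _ _)) // powR_exp2.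
have level i : (2 ^+ i) ^+ 2 * a ^+ i * #|E i|%:R <=
    (3 * a ^+ i / Q + 36 * b ^+ i) * (L ^+ 2 * Q).
  (* An empty level is set apart, since [levels] asks for t > 0. *)
  have [E0|E0] := posnP #|E i|.
    rewrite E0 mulr0 mulr_ge0 ?(ltW LQ0) // addr_ge0 ?mulr_ge0 ?invr_ge0 ?exprn_ge0 // ltW //.
  pose t := Num.sqrt (Num.sqrt (#|E i|%:R / (L ^+ 2 * Q))).
  have y0 : 0 < #|E i|%:R / (L ^+ 2 * Q) by rewrite divr_gt0 // ltr0n.
  have t0 : 0 < t by rewrite !sqrtr_gt0.
  have tE : #|E i|%:R = L ^+ 2 * Q * t ^+ 4.
    by rewrite (exprM t 2 2) !sqr_sqrtr ?sqrtr_ge0 ?(ltW y0) // mulrC divfK // gt_eqF.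
  rewrite tE mulrCA mulrC ler_wpM2r ?(ltW LQ0) // (mulrC ((2 ^+ i) ^+ 2)).
  apply: level_weight_le => //; rewrite ?exprn_ge0 ?exprn_ege1 ?ler1n // ?(ltW a0) //.
    by rewrite -!exprM ![(i * _)%N]mulnC !exprM -exprMn ba.
  by apply: (levels _ _ (E i)) => // [|m]; rewrite ?exprn_gt0 // inE.
(* The top term governs the series: 2^I <= L gives a^I <= L^e = Q. *)
have suma : \sum_(i < I.+1) a ^+ i <= a * Q / (a - 1).
  rewrite ler_pdivlMr ?subr_gt0 // mulrC -subrX1.
  apply: (@le_trans _ _ (a ^+ I.+1)); first by rewrite gerBl.
  rewrite exprS ler_wpM2l ?(ltW a0) // -powR_exp2 QE.
  by rewrite ge0_ler_powR ?nnegrE ?exprn_ge0 // ltW.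
have sumb : \sum_(i < I.+1) b ^+ i <= 1 / (1 - b).
  rewrite ler_pdivlMr ?subr_gt0 // mulrC -opprB mulNr -subrX1 opprB gerBl.
  by rewrite exprn_ge0.
apply: (le_trans (ler_sum _ (fun m _ => pointwise m))).
rewrite big_split /= exchange_big /= /dyadic_bound -/a -/b mulrDl mul1r lerD //.
apply: (@le_trans _ _ (\sum_(i < I.+1) powR 2 (2 + e) *
    ((3 * a ^+ i / Q + 36 * b ^+ i) * (L ^+ 2 * Q)))).
  apply: ler_sum => i _; rewrite -mulr_suml.
  have -> : \sum_m (m \in E i)%:R = #|E i|%:R :> R.
    by rewrite -sum1_card natr_sum [RHS]big_mkcond; apply: eq_bigr => m _; case: (m \in E i).
  by rewrite mulrCA ler_wpM2l ?powR_ge0 // mulrC.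
rewrite -mulr_sumr -mulr_suml -mulrA ler_wpM2l ?powR_ge0 // ler_wpM2r ?(ltW LQ0) //.
rewrite big_split /= -mulr_suml -!mulr_sumr lerD //.
  rewrite ler_pdivrMr // (_ : _ * Q = 3 * (a * Q / (a - 1))); last by ring.
  by rewrite ler_wpM2l.
by rewrite ler_wpM2l // -div1r.
Qed.

End Dyadic.

(** * The extension estimate *)

Section Restriction.
Variables (F : finFieldType) (R : realType) (chi : F -> complex R) (k : nat).
Hypothesis qF : (#|F| %% 4 = 3)%N.
Hypothesis chiP : nontrivial_additive_character chi.
Local Notation n := (4 * k + 2)%N.

(* Eighth roots make every power of [q] below an integral power of [rho]. *)
Variables (rho z : R).
Hypotheses (rho0 : 0 < rho) (rhoE : rho ^+ 8 = #|F|%:R) (zE : z = rho ^+ (4 * k)).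

Lemma z_gt0 : 0 < z.
Proof. by rewrite zE exprn_gt0. Qed.

(** With z = q^(k/2) carrying the dependence on k, later identities are polynomial with fixed
    exponents. *)
Lemma card_powE : (#|F| ^ n)%:R = z ^+ 8 * rho ^+ 16 :> R.
Proof. by rewrite natrX -rhoE zE -!exprM -exprD; congr (_ ^+ _); lia. Qed.

(** In terms of d = 4k + 3 the bound is q^(d-1) |E| + 2 q^((3d-2)/4) |E|^(3/2) + 2 q^((7d-2)/8)
    |E|^(5/4). The last two terms come from the two terms of the energy bound. *)
Lemma dual_bound (E : {set 'rV[F]_n.+1}) (omega : 'rV[F]_n.+1 -> complex R) (nu : R) :
  (forall m, cabs (omega m) = 1) -> 0 <= nu -> nu ^+ 4 = #|E|%:R ->
  \sum_y cabs (\sum_(m in E) omega m * chi (dotv m (plift y))) ^+ 2 <=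
  z ^+ 8 * rho ^+ 16 * nu ^+ 4 + 2 * z ^+ 6 * rho ^+ 14 * nu ^+ 6 +
  2 * z ^+ 7 * rho ^+ 19 * nu ^+ 5.
Proof.
move=> omega1 nu0 nuE; have z0 := z_gt0.
have gamE : (z ^+ 4 * rho ^+ 8) ^+ 2 = (#|F| ^ n)%:R by rewrite card_powE; ring.
have wE : (z ^+ 4 * rho ^+ 12) ^+ 2 = (#|F| ^ (4 * k + 3))%:R.
  by rewrite addnS expnS natrM card_powE -rhoE; ring.
have zr a b : 0 <= z ^+ a * rho ^+ b by rewrite mulr_ge0 ?exprn_ge0 ?ltW.
apply: (le_trans (sum_sqr_paraboloid_le qF chiP E omega1 (zr 4%N 8%N) gamE)).
rewrite card_powE -nuE.
pose alpha s : R := Num.sqrt (Num.sqrt #|slice E s|%:R).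
have alpha0 s : 0 <= alpha s by rewrite sqrtr_ge0.
have alpha4 s : #|slice E s|%:R = alpha s ^+ 4.
  by rewrite (exprM _ 2 2) !sqr_sqrtr ?sqrtr_ge0.
(* Fourth root of the Hölder and energy bounds; the factor 2 comes from 2(x^4 + y^4) <= 16(x +
   y)^4. *)
have slice_le s : \sum_(m in E | m 0 ord_max != s) cabs (slice_sum chi E omega s (slice_point s m)) <=
    2 * (nu ^+ 3 * (z ^+ 2 * rho ^+ 4)) * (alpha s ^+ 3 + z * rho ^+ 3 * alpha s ^+ 2).
  have rhs0 : 0 <= 2 * (nu ^+ 3 * (z ^+ 2 * rho ^+ 4)) * (alpha s ^+ 3 + z * rho ^+ 3 * alpha s ^+ 2).
    by rewrite !mulr_ge0 ?addr_ge0 ?exprn_ge0 // ?mulr_ge0 ?exprn_ge0 ?(ltW z0) ?(ltW rho0)//.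
  rewrite -(@ler_pXn2r _ 4) ?nnegrE // ?sumr_ge0 // => [|m _]; last exact: cabs_ge0.
  apply: (le_trans (slice_holder qF chiP E omega1 s)).
  rewrite expnS natrM card_powE -nuE.
  have := energy_le qF chiP (slice E s) (zr 4%N 12%N) wE.
  rewrite alpha4 [_ * energy _ _]mulrC.
  set G := energy R (slice E s); set A := alpha s => hG.
  have A0 : 0 <= A by exact: alpha0.
  have zr3 : 0 <= z * rho ^+ 3 by rewrite -[z]expr1 zr.
  apply: (@le_trans _ _ (nu ^+ 12 * (z ^+ 8 * rho ^+ 16 *
      (2 * (A ^+ 4) ^+ 3 + 2 * (z ^+ 4 * rho ^+ 12) * (A ^+ 4) ^+ 2)))).
    rewrite (_ : _ ^+ 3 * _ = nu ^+ 12 * (z ^+ 8 * rho ^+ 16 * (G * #|F|%:R))); last by ring.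
    by rewrite ler_wpM2l ?exprn_ge0 // ler_wpM2l.
  rewrite !exprMn (_ : _ * (_ * _) = nu ^+ 12 * (z ^+ 8 * rho ^+ 16) *
    (2 * ((A ^+ 3) ^+ 4 + (z * rho ^+ 3 * A ^+ 2) ^+ 4))); last by ring.
  rewrite [leRHS](_ : _ = nu ^+ 12 * (z ^+ 8 * rho ^+ 16) *
    (16 * (A ^+ 3 + z * rho ^+ 3 * A ^+ 2) ^+ 4)); last by ring.
  apply: ler_wpM2l; first by rewrite mulr_ge0 ?exprn_ge0.
  have : 0 <= A ^+ 3 by rewrite exprn_ge0.
  have : 0 <= z * rho ^+ 3 * A ^+ 2 by rewrite mulr_ge0 ?exprn_ge0.
  move: (A ^+ 3) (z * rho ^+ 3 * A ^+ 2) => x y y0 x0.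
  rewrite (_ : (x + y) ^+ 4 = x ^+ 4 + y ^+ 4 +
    (4 * (x ^+ 3 * y) + 6 * (x ^+ 2 * y ^+ 2) + 4 * (x * y ^+ 3))); last by ring.
  have := mulr_ge0 (exprn_ge0 3 x0) y0.
  have := mulr_ge0 (exprn_ge0 2 x0) (exprn_ge0 2 y0).
  have := mulr_ge0 x0 (exprn_ge0 3 y0).
  have := exprn_ge0 4 x0; have := exprn_ge0 4 y0; lra.
have alpha_sum4 : \sum_s alpha s ^+ 4 = nu ^+ 4.
  by rewrite nuE card_slices; apply: eq_bigr => s _; rewrite alpha4.
(* Cauchy-Schwarz over the q = rho^8 heights; once more for the cubes. *)
have alpha_sum2 : \sum_s alpha s ^+ 2 <= rho ^+ 4 * nu ^+ 2.
  rewrite -ler_sqr ?nnegrE ?sumr_ge0 ?mulr_ge0 ?exprn_ge0 ?(ltW rho0) //; last first.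
    by move=> s _; rewrite exprn_ge0.
  apply: (le_trans (sqr_sum_le _ _)).
  under eq_bigr => s _ do rewrite -exprM.
  by rewrite alpha_sum4 -rhoE exprMn -!exprM.
have alpha_sum3 : \sum_s alpha s ^+ 3 <= rho ^+ 2 * nu ^+ 3.
  rewrite -ler_sqr ?nnegrE ?sumr_ge0 ?mulr_ge0 ?exprn_ge0 ?(ltW rho0) //; last first.
    by move=> s _; rewrite exprn_ge0.
  under eq_bigr => s _ do rewrite exprS.
  apply: (le_trans (cauchy_schwarz _ _ _)).
  under [X in _ * X <= _]eq_bigr => s _ do rewrite -exprM.
  rewrite alpha_sum4; apply: (le_trans (ler_wpM2r (exprn_ge0 4 nu0) alpha_sum2)).
  by rewrite le_eqVlt; apply/orP; left; apply/eqP; ring.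
rewrite -addrA; apply: lerD => //.
apply: (@le_trans _ _ (z ^+ 4 * rho ^+ 8 * (2 * (nu ^+ 3 * (z ^+ 2 * rho ^+ 4)) *
    (rho ^+ 2 * nu ^+ 3 + z * rho ^+ 3 * (rho ^+ 4 * nu ^+ 2))))); last first.
  by rewrite le_eqVlt; apply/orP; left; apply/eqP; ring.
rewrite ler_wpM2l //; apply: (le_trans (ler_sum _ (fun s _ => slice_le s))).
rewrite -mulr_sumr ler_wpM2l ?mulr_ge0 ?exprn_ge0 ?(ltW z0) ?(ltW rho0) //.
rewrite big_split /= -mulr_sumr lerD // ler_wpM2l //.
by rewrite -[z]expr1 zr.
Qed.

Variable f : 'rV[F]_n.+1 -> complex R.
Let ext := ext_op (paraboloid F n) chi f.
Let S2 : R := (#|paraboloid F n|%:R)^-1 * \sum_(x in paraboloid F n) cabs (f x) ^+ 2.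

Lemma cardP_gt0 : 0 < #|paraboloid F n|%:R :> R.
Proof.
by rewrite card_paraboloid ltr0n expn_gt0 (ltn_trans _ (finNzRing_gt1 F)).
Qed.

Lemma cabs_cardPV : cabs ((#|paraboloid F n|%:R)^-1 : complex R) = (#|paraboloid F n|%:R)^-1.
Proof. by rewrite -[in RHS]cabs_nat; apply: Normc.normcV. Qed.

Lemma extE m : ext m = (#|paraboloid F n|%:R)^-1 * \sum_y f (plift y) * chi (dotv m (plift y)).
Proof.
by rewrite /ext /ext_op sum_paraboloid; congr (_ * _); apply: eq_bigr => y _; rewrite mulrC.
Qed.

Lemma S2E : S2 * #|paraboloid F n|%:R = \sum_y cabs (f (plift y)) ^+ 2.
Proof. by rewrite /S2 mulrAC mulVf ?mul1r ?gt_eqF ?cardP_gt0 // sum_paraboloid. Qed.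

Lemma ext_sum2 : \sum_m cabs (ext m) ^+ 2 = #|F|%:R * S2.
Proof.
have N0 : #|paraboloid F n|%:R != 0 :> R by rewrite gt_eqF ?cardP_gt0.
under eq_bigr => m _ do rewrite extE cabsM exprMn cabs_cardPV.
rewrite -mulr_sumr (plancherel_inj chiP _ (@plift_inj F n)) -S2E.
rewrite expnS natrM -[in (#|F| ^ _)%:R]card_paraboloid.
by field.
Qed.

Lemma ext_sup m : cabs (ext m) ^+ 2 <= S2.
Proof.
have N0 := cardP_gt0; rewrite extE cabsM exprMn cabs_cardPV exprVn mulrC.
rewrite ler_pdivrMr ?exprn_gt0 // expr2 mulrA S2E.
have le1 : cabs (\sum_y f (plift y) * chi (dotv m (plift y))) <= \sum_y cabs (f (plift y)).
  apply: (le_trans (cabs_sum _ _ _)); apply: ler_sum => y _.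
  by rewrite cabsM (cabs_chi chiP) mulr1.
have := sqr_sum_le xpredT (fun y => cabs (f (plift y))).
rewrite card_mx mul1n -card_paraboloid mulrC; apply: le_trans.
by rewrite ler_sqr ?nnegrE ?cabs_ge0 // (le_trans _ le1) ?cabs_ge0.
Qed.

(** Duality: the sum of |ext| over E is a pairing of f with the transform of a unimodular function
    on E, to which Cauchy-Schwarz and [dual_bound] apply. *)
Lemma ext_level (E : {set 'rV[F]_n.+1}) (lam nu : R) :
  0 <= lam -> 0 <= nu -> nu ^+ 4 = #|E|%:R -> (forall m, m \in E -> lam <= cabs (ext m)) ->
  lam ^+ 2 * nu ^+ 8 * (z ^+ 8 * rho ^+ 16) <=
  S2 * (z ^+ 8 * rho ^+ 16 * nu ^+ 4 + 2 * z ^+ 6 * rho ^+ 14 * nu ^+ 6 +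
        2 * z ^+ 7 * rho ^+ 19 * nu ^+ 5).
Proof.
move=> lam0 nu0 nuE lamE.
(* The conjugate phase of [ext], set to 1 at its zeros so as to be unimodular everywhere. *)
pose omega m : complex R := if ext m == 0 then 1 else (ext m)^*%C * ((cabs (ext m))^-1)%:C%C.
have cabs_neq0 m : ext m != 0 -> cabs (ext m) != 0.
  by apply: contra_neq => /Normc.eq0_normc.
have omega1 m : cabs (omega m) = 1.
  rewrite /omega; case: eqVneq => [_|/cabs_neq0 h]; first exact: cabs1.
  by rewrite cabsM cabsJ cabs_real ?invr_ge0 ?cabs_ge0 // mulfV.
have omegaE m : omega m * ext m = (cabs (ext m))%:C%C.
  rewrite /omega; case: eqVneq => [->|/cabs_neq0 h]; first by rewrite cabs0 mulr0.
  by rewrite mulrAC (mulrC _^*%C) -cabs_sqr -rmorphM /= expr2 mulfK.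
have hat0 := dual_bound omega1 nu0 nuE.
have N0 := cardP_gt0.
set hat := fun y => \sum_(m in E) omega m * chi (dotv m (plift y)) in hat0.
have sumE : (\sum_(m in E) cabs (ext m)) =
    (#|paraboloid F n|%:R)^-1 * cabs (\sum_y f (plift y) * hat y).
  rewrite -cabs_cardPV -cabsM -[LHS]cabs_real ?sumr_ge0 // => [|m _]; last exact: cabs_ge0.
  congr cabs; rewrite rmorph_sum /=; under eq_bigr => m _ do rewrite -omegaE extE mulrCA.
  rewrite -mulr_sumr; congr (_ * _).
  under eq_bigr => m _ do rewrite mulr_sumr.
  rewrite exchange_big; apply: eq_bigr => y _ /=.
  by rewrite /hat mulr_sumr; apply: eq_bigr => m _; rewrite mulrCA.
have lamN : lam * nu ^+ 4 <= \sum_(m in E) cabs (ext m).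
  by rewrite nuE mulrC mulr_natl -sumr_const; apply: ler_sum.
have fhat : cabs (\sum_y f (plift y) * hat y) ^+ 2 <=
    S2 * #|paraboloid F n|%:R * \sum_y cabs (hat y) ^+ 2.
  rewrite S2E; apply: le_trans (cauchy_schwarz _ _ _).
  have le1 : cabs (\sum_y f (plift y) * hat y) <= \sum_y cabs (f (plift y)) * cabs (hat y).
    by apply: (le_trans (cabs_sum _ _ _)); apply: ler_sum => y _; rewrite cabsM.
  by rewrite ler_sqr ?nnegrE ?cabs_ge0 // (le_trans _ le1) ?cabs_ge0.
have S20 : 0 <= S2.
  by rewrite mulr_ge0 ?invr_ge0 // sumr_ge0 // => x _; rewrite sqr_ge0.
apply: le_trans (ler_wpM2l S20 hat0).
rewrite -card_powE -card_paraboloid -(ler_pM2l N0).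
apply: (@le_trans _ _ (S2 * #|paraboloid F n|%:R * \sum_y cabs (hat y) ^+ 2)); last first.
  by rewrite mulrCA mulrA.
apply: le_trans fhat.
have h : lam * nu ^+ 4 * #|paraboloid F n|%:R <= cabs (\sum_y f (plift y) * hat y).
  by move: lamN; rewrite sumE ler_pdivlMl // mulrC.
set N := #|paraboloid F n|%:R in h *.
rewrite (_ : N * _ = (lam * nu ^+ 4 * N) ^+ 2); last by ring.
have h0 : 0 <= lam * nu ^+ 4 * N by rewrite !mulr_ge0 ?exprn_ge0.
by rewrite ler_sqr ?nnegrE ?cabs_ge0.
Qed.

End Restriction.

(** * Rescaling and conclusion *)

Section Main.
Variables (F : finFieldType) (R : realType) (chi : F -> complex R) (k : nat).
Hypothesis qF : (#|F| %% 4 = 3)%N.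
Hypothesis chiP : nontrivial_additive_character chi.
Hypothesis k_gt0 : (0 < k)%N.
Local Notation n := (4 * k + 2)%N.
Local Notation e := (4 / (4 * k + 3)%:R : R).

Lemma norm_sigma2E (f : 'rV[F]_n.+1 -> complex R) :
  norm_sigma (paraboloid F n) 2 f =
  Num.sqrt ((#|paraboloid F n|%:R)^-1 * \sum_(x in paraboloid F n) cabs (f x) ^+ 2).
Proof.
rewrite /norm_sigma; under eq_bigr => x _ do rewrite powR_mulrn ?cabs_ge0 //.
by rewrite powR12_sqrt // mulr_ge0 ?invr_ge0 // sumr_ge0 // => x _; rewrite sqr_ge0.
Qed.

Lemma extension_sum_le (f : 'rV[F]_n.+1 -> complex R) (S : R) : 0 < S ->
  S ^+ 2 = (#|paraboloid F n|%:R)^-1 * \sum_(x in paraboloid F n) cabs (f x) ^+ 2 ->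
  \sum_m powR (cabs (ext_op (paraboloid F n) chi f m)) (2 + e) <=
  dyadic_bound e * powR S (2 + e).
Proof.
have dE : (4 * k * 2 + 6 = 2 * (4 * k + 3))%N by lia.
have d7 : (7 <= 4 * k + 3)%N by move: k_gt0; clear; lia.
move=> S0 SE.
set ext := ext_op _ _ _.
have q1 : 1 <= #|F|%:R :> R by rewrite ler1n (ltn_trans _ (finNzRing_gt1 F)).
have q0 : 0 < #|F|%:R :> R by apply: lt_le_trans q1.
pose rho : R := Num.sqrt (Num.sqrt (Num.sqrt #|F|%:R)).
have rho0 : 0 < rho by rewrite !sqrtr_gt0.
have rhoE : rho ^+ 8 = #|F|%:R.
  by rewrite (exprM _ 2 4) (exprM _ 2 2) !sqr_sqrtr ?sqrtr_ge0.
have rho1 : 1 <= rho by rewrite -(@ler_pXn2r _ 8) ?nnegrE ?ler01 ?(ltW rho0) // expr1n rhoE.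
pose z := rho ^+ (4 * k).
have z0 : 0 < z by rewrite exprn_gt0.
(* L = rho^(2d) = q^(d/4), the inverse of the critical level; hence q = L^e with e = 4/d. *)
pose L := z ^+ 2 * rho ^+ 6.
have L1 : 1 <= L by rewrite /L /z -exprM -exprD exprn_ege1.
have L0 : 0 < L by apply: lt_le_trans L1.
have d0 : (4 * k + 3)%:R != 0 :> R by rewrite pnatr_eq0 addn3.
have e0 : 0 < e by rewrite divr_gt0 // ltr0n addn3.
(* This is d > 6, which holds because k > 0 gives d >= 7. *)
have e23 : e < 2 / 3.
  have : 7 <= (4 * k + 3)%:R :> R by rewrite ler_nat.
  by rewrite ltr_pdivrMr ?ltr0n ?addn3 //; lra.
have LQ : #|F|%:R = powR L e.
  have -> : L = powR rho (2 * (4 * k + 3)%:R).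
    by rewrite -natrM powR_mulrn ?(ltW rho0) // /L /z -exprM -exprD dE.
  rewrite -powRrM (_ : _ * _ = 8%:R); last by rewrite -mulrA [_ * (4 / _)]mulrC divfK // -natrM.
  by rewrite powR_mulrn ?(ltW rho0).
have re0 : 0 <= 2 + e by rewrite addr_ge0 // ltW.
pose psi m := L / S * cabs (ext m).
have LS0 : 0 < L / S by rewrite divr_gt0.
have psi0 m : 0 <= psi m by rewrite mulr_ge0 ?cabs_ge0 // ltW.
have psiL m : psi m <= L.
  rewrite /psi mulrAC -mulrA ger_pMr // ler_pdivrMr // mul1r.
  by rewrite -ler_sqr ?nnegrE ?cabs_ge0 ?(ltW S0) // SE; apply: ext_sup.
have psi2 : \sum_m psi m ^+ 2 <= L ^+ 2 * #|F|%:R.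
  under eq_bigr => m _ do rewrite exprMn.
  rewrite -mulr_sumr (ext_sum2 chiP) -SE le_eqVlt; apply/orP; left; apply/eqP.
  by field; rewrite gt_eqF.
have bound := dyadic_sum e0 e23 L1 LQ psi0 psiL psi2.
have levels (x t : R) (E : {set 'rV[F]_n.+1}) : 0 < x -> 0 < t ->
    #|E|%:R = L ^+ 2 * #|F|%:R * t ^+ 4 -> (forall m, m \in E -> x <= psi m) ->
    x ^+ 2 * t ^+ 4 * #|F|%:R <= 1 + 2 * #|F|%:R * t ^+ 2 + 2 * #|F|%:R * t.
  move=> x0 t0 cardE xpsi.
  (* The fourth root of |E|, as L^2 q = (z rho^5)^4. *)
  pose nu := z * rho ^+ 5 * t.
  have nu0 : 0 < nu by rewrite !mulr_gt0 ?exprn_gt0.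
  have nuE : nu ^+ 4 = #|E|%:R by rewrite cardE -rhoE /nu /L; ring.
  have lam0 : 0 <= x * (S / L) by rewrite mulr_ge0 ?divr_ge0 ?ltW.
  have lamE m : m \in E -> x * (S / L) <= cabs (ext m).
    move=> /xpsi; rewrite /psi mulrC -ler_pdivrMr // invfM invrK.
    by rewrite [_^-1 * _]mulrC.
  have := ext_level qF chiP rho0 rhoE (erefl z) lam0 (ltW nu0) nuE lamE.
  rewrite -SE -rhoE.
  (* Dividing by this common factor normalises the diagonal term to 1. *)
  have c0 : 0 < S ^+ 2 * (z ^+ 12 * rho ^+ 36 * t ^+ 4).
    by rewrite !mulr_gt0 ?exprn_gt0.
  rewrite (_ : _ * (z ^+ 8 * rho ^+ 16) = x ^+ 2 * t ^+ 4 * rho ^+ 8 *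
    (S ^+ 2 * (z ^+ 12 * rho ^+ 36 * t ^+ 4))); last first.
    by rewrite /nu /L; field; rewrite !gt_eqF.
  rewrite (_ : S ^+ 2 * (_ + _ + _) = (1 + 2 * rho ^+ 8 * t ^+ 2 + 2 * rho ^+ 8 * t) *
    (S ^+ 2 * (z ^+ 12 * rho ^+ 36 * t ^+ 4))); last by rewrite /nu; ring.
  by rewrite ler_pM2r.
move: (bound levels).
have -> : \sum_m powR (psi m) (2 + e) = powR (L / S) (2 + e) * \sum_m powR (cabs (ext m)) (2 + e).
  by rewrite mulr_sumr; apply: eq_bigr => m _; rewrite /psi powRM ?cabs_ge0 ?(ltW LS0).
have -> : L ^+ 2 * #|F|%:R = powR (L / S) (2 + e) * powR S (2 + e).
  by rewrite -powRM ?(ltW LS0) ?(ltW S0) // divfK ?gt_eqF // powR2D ?(ltW L0) // -LQ.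
by rewrite mulrCA ler_pM2l // powR_gt0.
Qed.

(** Read off from the estimate itself for the constant function 1, whose norm is positive. *)
Lemma dyadic_bound_ge0 : 0 <= dyadic_bound e.
Proof.
have h : (0 : 'rV[F]_n.+1) \in paraboloid F n.
  by rewrite paraboloidE; apply/imsetP; exists 0 => //; rewrite /plift; apply/rowP => i;
     rewrite !mxE; case: unliftP => [j|] _ //=; rewrite ?mxE ?dotv0r.
pose S : R := Num.sqrt ((#|paraboloid F n|%:R)^-1 * \sum_(x in paraboloid F n) cabs (1 : complex R) ^+ 2).
have S20 : 0 < (#|paraboloid F n|%:R)^-1 * \sum_(x in paraboloid F n) cabs (1 : complex R) ^+ 2 :> R.
  under eq_bigr do rewrite cabs1 expr1n.
  by rewrite sumr_const mulVf // gt_eqF ?cardP_gt0.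
have S0 : 0 < S by rewrite sqrtr_gt0.
have := extension_sum_le S0 (sqr_sqrtr (ltW S20)).
have Sr : 0 < powR S (2 + e) by rewrite powR_gt0.
move=> H; rewrite -(pmulr_lge0 _ Sr); apply: le_trans H.
by apply: sumr_ge0 => m _; rewrite powR_ge0.
Qed.

Lemma paraboloid_extension :
  extension_bound (paraboloid F n) chi 2 ((2 * (4 * k + 3)%:R + 4) / (4 * k + 3)%:R)
    (powR (dyadic_bound e) (2 + e)^-1).
Proof.
have d0 : (4 * k + 3)%:R != 0 :> R by rewrite pnatr_eq0 addn3.
rewrite mulrDl mulfK // => f; rewrite norm_sigma2E.
set S2 := _^-1 * _; have S20 : 0 <= S2.
  by rewrite mulr_ge0 ?invr_ge0 // sumr_ge0 // => x _; rewrite sqr_ge0.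
have r0 : 0 < 2 + e :> R by rewrite addr_gt0 // divr_gt0 // ltr0n addn3.
have [S0|S0] := leP S2 0; last first.
  have sqrtS0 : 0 < Num.sqrt S2 by rewrite sqrtr_gt0.
  have h := extension_sum_le sqrtS0 (sqr_sqrtr S20).
  rewrite /norm_count.
  have -> : Num.sqrt S2 = powR (powR (Num.sqrt S2) (2 + e)) (2 + e)^-1.
    by rewrite -powRrM mulfV ?gt_eqF // powRr1 // ltW.
  rewrite -powRM ?powR_ge0 ?dyadic_bound_ge0 //.
  rewrite ge0_ler_powR ?invr_ge0 ?(ltW r0) // nnegrE.
    by apply: sumr_ge0 => m _; rewrite powR_ge0.
  by rewrite mulr_ge0 ?dyadic_bound_ge0 ?powR_ge0.
(* If f has norm 0, rescaling is impossible, but the sup bound makes the extension vanish; the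
   exponents are nonzero, so [powR] of 0 is 0. *)
rewrite ler0_sqrtr // mulr0 /norm_count big1 => [|m _].
  by rewrite powR0 // invr_eq0 gt_eqF.
have : cabs (ext_op (paraboloid F n) chi f m) ^+ 2 <= 0.
  exact: le_trans (ext_sup chiP f m) S0.
rewrite real_exprn_even_le0 ?num_real //= => /eqP ->.
by rewrite powR0 // gt_eqF.
Qed.

End Main.

Unset Implicit Arguments.

(* d = 4k+3 = (4k+2).+1 ; r = (2d+4)/d ; p = 2 *)
Theorem theorem1p4 (R : realType) (k : nat) (hk : (0 < k)%N) :
  exists C : R, forall (F : finFieldType), (#|F| %% 4 = 3)%N ->
    forall chi : F -> complex R, nontrivial_additive_character chi ->
      extension_bound (paraboloid F (4 * k + 2)) chi 2
        ((2 * (4 * k + 3)%:R + 4) / (4 * k + 3)%:R) C.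
Proof.
(* The constant depends on k alone, through e = 4/d. *)
exists (powR (dyadic_bound (4 / (4 * k + 3)%:R)) (2 + 4 / (4 * k + 3)%:R)^-1).
by move=> F qF chi chiP; apply: paraboloid_extension.
Qed.
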